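(* Let $t \ge 4$ be an integer and let $(G, C)$ be a circuit graph with outer cycle $C$ such that $v(G) \ge t$ and $$m(G) < \frac{v(G) - (t-1)}{3t-7}.$$ Then $G$ has a subgraph $T$ which is a near triangulation with $v(T) \ge t$.
   Context: For a graph $G$, $v(G)$ and $e(G)$ denote its numbers of vertices and edges. A circuit graph is a pair $(G, C)$ where $G$ is a $2$-connected plane graph and $C$ is a facial cycle of $G$ (taken as the outer cycle) such that for every $2$-vertex cut $S$ of $G$, each component of $G - S$ contains a vertex of $C$. A near triangulation is a plane graph in which every face, except possibly the outer face, is bounded by a triangle. For a $2$-connected plane graph $G$ with outer cycle $C$, $m(G) = 3v(G) - 6 - e(G) - (|C| - 3)$, which is the number of interior edges that must be added to make $G$ a near triangulation. *)

(* Defs.v *)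
From HB Require Import structures.
From mathcomp Require Import all_boot all_order all_algebra.

Set Implicit Arguments.
Unset Strict Implicit.
Unset Printing Implicit Defensive.

(* A finite simple graph whose vertices form a subset of V, so that subgraphs
   and vertex deletions stay over the same V. *)
Record graph (V : finType) := Graph {
  verts : {set V};
  adj : rel V;
  adj_sym : symmetric adj;
  adj_irr : irreflexive adj;
  adj_verts : forall x y, adj x y -> x \in verts }.

Section Graphs.
Variable V : finType.
Implicit Types (H K : graph V) (S : {set V}).

Definition edges H : {set {set V}} :=
  [set [set d.1; d.2] | d : V * V & adj H d.1 d.2].

Definition nb_verts H : nat := #|verts H|.
Definition nb_edges H : nat := #|edges H|.

Definition subgraph K H : Prop :=
  verts K \subset verts H /\ subrel (adj K) (adj H).

Definition del_adj H S : rel V :=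
  fun x y => [&& adj H x y, x \notin S & y \notin S].

Lemma del_adj_sym H S : symmetric (del_adj H S).
Proof. by move=> x y; rewrite /del_adj adj_sym; congr andb; rewrite andbC. Qed.

Lemma del_adj_irr H S : irreflexive (del_adj H S).
Proof. by move=> x; rewrite /del_adj adj_irr. Qed.

Lemma del_adj_verts H S x y : del_adj H S x y -> x \in verts H :\: S.
Proof. by case/and3P=> /adj_verts xH xS _; rewrite inE xS. Qed.

Definition del_verts H S : graph V :=
  Graph (@del_adj_sym H S) (@del_adj_irr H S) (@del_adj_verts H S).

Definition components H : {set {set V}} :=
  [set [set y | connect (adj H) x y] | x in verts H].

Definition connected H : bool :=
  [forall x in verts H, forall y in verts H, connect (adj H) x y].

Definition two_connected H : Prop :=
  (2 < nb_verts H)%N /\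
  forall S, S \subset verts H -> (#|S| < 2)%N -> connected (del_verts H S).

Definition two_vertex_cut H S : Prop :=
  [/\ S \subset verts H, #|S| = 2 & ~~ connected (del_verts H S)].

End Graphs.

(* A graph with a rotation system: for a neighbour y of x, rot x y is the
   neighbour of x that follows y in the cyclic order around x.  Transitivity
   of rot x on the finite set of neighbours of x makes it a single cycle there;
   its values elsewhere are irrelevant. *)
Record embedded_graph (V : finType) := EmbeddedGraph {
  eg_graph :> graph V;
  rot : V -> V -> V;
  rot_adj : forall x y, adj eg_graph x y -> adj eg_graph x (rot x y);
  rot_trans : forall x y z,
    adj eg_graph x y -> adj eg_graph x z -> fconnect (rot x) y z }.

Section PlaneGraphs.
Variable V : finType.
Implicit Types (G : embedded_graph V) (H : graph V) (C : seq V).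
Implicit Types (F : {set V * V}).

(* The pair (x, y) is the edge xy oriented from x to y; it also stands for one
   of the two sides of that edge, so each dart lies on exactly one face. *)
Definition darts H : {set V * V} := [set d | adj H d.1 d.2].

(* Successor of a dart along the boundary of its face. *)
Definition face_step G (d : V * V) : V * V := (d.2, rot G d.2 d.1).

(* Faces of a subgraph H of G, drawn as in G: removing an edge of G merges the
   faces on its two sides, so a face of H is a union of faces of G, given here
   by the darts of G on it or in its interior.  For H = G the faces are
   the orbits of face_step on the darts of G. *)
Definition face_link G H : rel (V * V) := fun d d' =>
  (d' == face_step G d) || ((d \in darts G :\: darts H) && (d' == (d.2, d.1))).

Definition face_at G H (d : V * V) : {set V * V} :=
  [set d' | connect (face_link G H) d d'].

Definition faces G H : {set {set V * V}} := [set face_at G H d | d in darts G].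

(* Connected, with an edge, and of genus 0 by Euler's formula; a 2-connected
   plane graph is determined, up to homeomorphism of the sphere, by such data. *)
Definition plane G : Prop :=
  connected G /\ (nb_verts G + #|faces G G| = nb_edges G + 2)%N.

Definition cycle_darts C : seq (V * V) := [seq (x, next C x) | x <- C].

(* C is listed in the direction in which face_step traverses the face. *)
Definition facial_cycle G C : Prop :=
  [/\ (2 < size C)%N, uniq C, cycle (adj G) C
    & fcycle (face_step G) (cycle_darts C)].

(* The outer face of H is the one containing the face of G bounded by C. *)
Definition outer_face C F : bool := has (mem F) (cycle_darts C).

Definition circuit_graph G C : Prop :=
  [/\ plane G, two_connected G, facial_cycle G C
    & forall S, two_vertex_cut G S ->
      forall K, K \in components (del_verts G S) -> exists2 x, x \in C & x \in K].

Definition boundary_edges H F : {set {set V}} :=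
  [set [set d.1; d.2] | d in F :&: darts H].

Definition bounded_by_triangle H F : Prop :=
  exists x y z : V, uniq [:: x; y; z] /\
    boundary_edges H F = [set [set x; y]; [set y; z]; [set z; x]].

(* The subgraph T of G, drawn as in G, is a near triangulation.  Without
   2-connectedness every edgeless graph and every tree, having only the outer
   face, would qualify. *)
Definition near_triangulation G C (T : graph V) : Prop :=
  two_connected T /\
  forall F, F \in faces G T -> ~~ outer_face C F -> bounded_by_triangle T F.

(* An integer, since the natural-number subtractions would truncate. *)
Definition missing_edges G C : int :=
  (3 * (nb_verts G)%:Z - 6 - (nb_edges G)%:Z - ((size C)%:Z - 3))%R.

End PlaneGraphs.

(* Main.v *)
(* Work in the dual graph on the faces of G.  Call a set X of inner faces a disc
   if it is connected in the dual and so is its complement, which contains the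
   outer face, and let V(X) be the set of vertices on faces of X.  If all faces
   of a disc X are triangles, the edges on X form a near triangulation, because
   the other faces merge into a single one.  Assume that no disc of triangles has
   t or more vertices.  Then every disc X satisfies
     |V(X)| <= (t - 1) + (3t - 7) * (sum over h in X of (|h| - 3)),
   and for X the set of all inner faces the sum equals m(G) by Euler's formula.

   The bound is proved by induction on |X|.  If X has a face with more than three
   sides, choose a connected, possibly empty, set B of triangles of X such that
   X \ B is connected, the complement of B is connected, and a face f of X with
   |f| > 3 has an edge leading to B (to the complement of X if B is empty).
   Deleting B loses at most t - 3 vertices, since B has fewer than t vertices and
   keeps the ends of that edge.  Deleting f as well leaves at most |f| - 1 pieces
   of X \ B, strung along the rest of the boundary of f; they are discs, so the
   induction hypothesis applies to each of them.

   The choice of B uses that no face g separates the dual.  By Euler's formula a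
   function to F_2 on the edges whose sum around every face is 0 is a coboundary.
   If g separated a set P of faces from the others, then for each vertex u the
   indicator of the edges at u on a face of P would be such a function; as G - u
   is connected, all edges at u or none would lie on a face of P, and the same
   would hold for the edges of the connected graph G. *)

Require Import Defs.
From HB Require Import structures.
From mathcomp Require Import all_boot all_order all_algebra.
From mathcomp Require Import zify lra.

Set Implicit Arguments.
Unset Strict Implicit.
Unset Printing Implicit Defensive.
Import Order.TTheory GRing.Theory Num.Theory.

(** * Connected sets of nodes *)

Section Connectivity.
Variables (N : finType) (r : rel N).
Hypothesis r_sym : symmetric r.
Implicit Types (A B H K O S W X Y : {set N}) (x y z : N).

Definition induced X : rel N := fun x y => [&& r x y, x \in X & y \in X].
Definition conn X := [forall x in X, forall y in X, connect (induced X) x y].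
(** Contains [x] even when [x] lies outside [X], because [connect] is reflexive. *)
Definition component X x := [set y | connect (induced X) x y].

Lemma induced_connect_sym X : connect_sym (induced X).
Proof.
by apply: sym_connect_sym => x y; rewrite /induced r_sym [(x \in X) && _]andbC.
Qed.

Lemma connP X : reflect {in X &, forall x y, connect (induced X) x y} (conn X).
Proof.
apply: (iffP forall_inP) => h x => [y xX yX|xX].
  by move/forall_inP: (h x xX); apply.
by apply/forall_inP => y; apply: h.
Qed.

Lemma conn_ind X (P : pred N) x : conn X -> x \in X -> P x ->
    (forall y z, y \in X -> z \in X -> r y z -> P y -> P z) ->
  {in X, forall y, P y}.
Proof.
move=> /connP cX xX Px step y yX; case/connectP: (cX x y xX yX) => p.
elim: p x xX Px => [|z p IH] x xX Px /=; first by move=> _ ->.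
by case/andP=> /and3P[rxz _ zX]; apply: IH => //; apply: (step x).
Qed.

Lemma connect_induced_sub X Y x y :
  X \subset Y -> connect (induced X) x y -> connect (induced Y) x y.
Proof.
move/subsetP=> sXY; apply: connect_sub => u v /and3P[ruv uX vX].
by apply: connect1; rewrite /induced ruv !sXY.
Qed.

Lemma component_refl X x : x \in component X x.
Proof. by rewrite inE. Qed.

Lemma component_sub X x : x \in X -> component X x \subset X.
Proof.
move=> xX; apply/subsetP=> y; rewrite inE => /connectP[p].
elim: p x xX => [|z p IH] x xX /=; first by move=> _ ->.
by case/andP=> /and3P[_ _ zX]; apply: IH.
Qed.

Lemma component_mem X x y : x \in X -> y \in component X x -> y \in X.
Proof. by move/component_sub/subsetP; apply. Qed.

Lemma component_closed X x y z : x \in X ->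
  y \in component X x -> z \in X -> r y z -> z \in component X x.
Proof.
move=> xX yC zX ryz; have yX := subsetP (component_sub xX) y yC.
move: yC; rewrite !inE => cxy; apply: connect_trans cxy _.
by apply: connect1; rewrite /induced ryz yX.
Qed.

Lemma component_eq X x y : y \in component X x -> component X y = component X x.
Proof.
rewrite inE => cxy; apply/setP=> z; rewrite !inE.
exact/esym/(same_connect (induced_connect_sym X)).
Qed.

Lemma conn_root X x :
  {in X, forall y, connect (induced X) x y} -> conn X.
Proof.
move=> h; apply/connP => y z yX zX.
by apply: connect_trans (h z zX); rewrite induced_connect_sym h.
Qed.

Lemma conn_comp X x : x \in X -> conn (component X x).
Proof.
move=> xX; apply: (@conn_root _ x) => y; rewrite inE => /connectP[p].
elim/last_ind: p y => [|p z IH] y /=; first by move=> _ ->; apply: connect0.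
rewrite rcons_path last_rcons => /andP[xp /and3P[rz lX zX]] ->.
have cl : last x p \in component X x by rewrite inE; apply/connectP; exists p.
apply: connect_trans (IH _ xp erefl) _; apply: connect1.
by rewrite /induced rz cl (component_closed xX cl).
Qed.

Lemma conn_sub_comp X Y x : conn Y -> Y \subset X -> x \in Y ->
  Y \subset component X x.
Proof.
move=> /connP cY sYX xY; apply/subsetP=> y yY; rewrite inE.
exact: connect_induced_sub sYX (cY _ _ _ _).
Qed.

Lemma component_disjoint X x y z : 
  y \notin component X x -> z \in component X y -> z \notin component X x.
Proof.
move=> yx zy; apply: contra yx => zx.
by rewrite -(component_eq zx) (component_eq zy) component_refl.
Qed.

(** If no edge left the component for [K :\: S], the component would be closed under adjacency in
    [K] and, as [K] is connected, would contain [k]. *)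
Lemma component_exit K S x k : conn K -> S \subset K -> x \in S -> k \in K ->
    k \notin S ->
  exists2 y, y \in component S x & exists2 k', k' \in K :\: S & r y k'.
Proof.
move=> cK sSK xS kK kS.
have xK := subsetP sSK x xS.
have [/exists_inP[y yC /exists_inP[k' kk ryk]]|] :=
  boolP [exists y in component S x, exists k' in K :\: S, r y k'].
  by exists y => //; exists k'.
move=> hN; case/negP: kS; apply: (subsetP (component_sub xS)).
apply: (@conn_ind K (mem (component S x)) x) => //; first exact: component_refl.
move=> y z yK zK ryz yC; have [zS|zS] := boolP (z \in S).
  exact: component_closed yC zS ryz.
case/negP: hN; apply/exists_inP; exists y => //; apply/exists_inP; exists z => //.
by rewrite inE zS.
Qed.

Lemma component_exit1 K x g : conn K -> g \in K -> x \in K :\ g ->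
  exists2 y, y \in component (K :\ g) x & r y g.
Proof.
move=> cK gK xK; have gg : g \notin K :\ g by rewrite !inE eqxx.
have [y yC [k kK ryk]] := component_exit cK (subsetDl _ _) xK gK gg.
exists y => //; move: kK; rewrite in_setD in_setD1 negb_and negbK.
by case/andP=> /orP[/eqP<-//|/negP nk] /nk.
Qed.

(** The pieces attached to the hub [H] are usually the components left after the deletion of a
    node. *)
Lemma conn_hub H X : conn H -> H \subset X ->
    (forall x, x \in X -> x \notin H -> exists2 C : {set N},
       [/\ conn C, C \subset X & x \in C]
       & exists2 y, y \in C & exists2 h, h \in H & r y h) ->
  conn X.
Proof.
move=> cH sHX att.
have toH x : x \in X -> x \notin H ->
    exists2 h, h \in H & connect (induced X) x h.
  move=> xX xH; have [C [/connP cC sC xC] [y yC [h hH ryh]]] := att x xX xH.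
  exists h => //; apply: connect_trans (connect_induced_sub sC (cC x y xC yC)) _.
  by apply: connect1; rewrite /induced ryh (subsetP sC) // (subsetP sHX).
have toH' x : x \in X -> exists2 h, h \in H & connect (induced X) x h.
  by move=> xX; have [xH|xH] := boolP (x \in H); [exists x | exact: toH].
apply/connP=> x y xX yX.
have [h hH xh] := toH' x xX; have [k kH yk] := toH' y yX.
apply: connect_trans xh _; rewrite induced_connect_sym.
apply: connect_trans yk _; apply: connect_induced_sub sHX _.
by move/connP: cH; apply.
Qed.

Lemma conn_set1 x : conn [set x].
Proof. by apply/connP => y z /set1P-> /set1P->; apply: connect0. Qed.

Lemma conn_set0 : conn set0.
Proof. by apply/connP => y z; rewrite inE. Qed.

Lemma connU X Y x y : conn X -> conn Y -> x \in X -> y \in Y -> r y x ->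
  conn (X :|: Y).
Proof.
move=> cX cY xX yY ryx; apply: (conn_hub cX); first exact: subsetUl.
move=> z; rewrite inE => /orP[->//|zY] _.
by exists Y; [rewrite subsetUr | exists y => //; exists x].
Qed.

(** * Choosing a connected set of good nodes next to a bad node *)

Section Selection.
Variables (W : {set N}) (bad : pred N).
Hypothesis conn_del : forall g, g \in W -> conn (W :\ g).

(* The node k, adjacent to O, must stay outside A: this keeps W \ A adjacent to O,
   so that a single component of A \ O does not surround the rest of W \ O. *)
Lemma select_bond (O : {set N}) o k : O \subset W -> conn O -> conn (W :\: O) ->
    o \in O -> k \in W :\: O -> r o k -> [exists z in W :\: O, bad z] ->
  exists A, [/\ O \subset A /\ A \subset W, conn A /\ conn (W :\: A),
     k \notin A, {in A :\: O, forall x, ~~ bad x}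
     & exists2 a, a \in A & exists2 f, f \in W :\: A & bad f && r a f].
Proof.
move=> sOW cO cX oO kX rok badX.
(* Among the sets A with these properties take a largest one.  If it touches no
   bad node, absorbing a neighbour g' of A must cut off a bad node from k; then a
   neighbour of A inside the part cut off cuts off a strictly smaller part. *)
set concl := ex _.
suff grow n : forall A, #|W :\: A| <= n -> O \subset A -> A \subset W ->
    conn A -> conn (W :\: A) -> k \notin A ->
    {in A :\: O, forall x, ~~ bad x} ->
    concl.
  apply: (grow #|W :\: O| O) => //; first by case/setDP: kX.
  by move=> x; rewrite setDv inE.
elim: n => [|n IHn] A.
  rewrite leqn0 cards_eq0 => /eqP WA _ _ _ _ kA.
  by case/setDP: kX => kW _; move/setP/(_ k): WA; rewrite !inE kA kW.
move=> leA sOA sAW cA cK kA gA; set K := W :\: A in leA cK *.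
have [/exists_inP[a aA /exists_inP[f fK bf]]|noadj] :=
  boolP [exists a in A, exists f in K, bad f && r a f].
  by exists A; split=> //; exists a => //; exists f.
have {noadj} noadj a f : a \in A -> f \in K -> r a f -> ~~ bad f.
  move=> aA fK raf; apply: contra noadj => bf.
  by apply/exists_inP; exists a => //; apply/exists_inP; exists f; rewrite ?bf.
have kK : k \in K by rewrite inE kA; case/setDP: kX.
have oA := subsetP sOA o oO.
suff shrink m : forall g z, g \in K -> z \in K :\ g -> bad z ->
    k \notin component (K :\ g) z -> #|component (K :\ g) z| <= m ->
    concl.
  case/exists_inP: badX => z zX bz.
  have zK : z \in K.
    case/setDP: zX => zW zO; rewrite inE zW andbT.
    by apply/negP => zA; move: (gA z); rewrite inE zA zO bz => /(_ isT).
  (* The descent starts with [g = k]: being adjacent to [o] in [A], [k] is not bad, so it differs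
     from [z], and it is outside any component of [K :\ k]. *)
  have zk : z \in K :\ k.
    rewrite !inE; rewrite inE in zK; rewrite zK andbT.
    by apply: contraL bz => /eqP->; apply: noadj rok.
  apply: (shrink #|component (K :\ k) z| k z) => //.
  by apply/negP => /(subsetP (component_sub zk)); rewrite !inE eqxx.
elim: m => [|m IHm] g z gK zKg bz kZ.
  by rewrite leqn0 cards_eq0 => /eqP Z0; have := component_refl (K :\ g) z; rewrite Z0 inE.
set Z := component _ z in kZ *; move=> leZ.
have gW : g \in W by case/setDP: gK.
have sKgW : K :\ g \subset W :\ g by rewrite setSD // subsetDl.
have oWg : o \in W :\ g.
  by rewrite !inE (subsetP sAW) // andbT; apply: contraTneq gK => <-; rewrite inE oA.
have oKg : o \notin K :\ g by rewrite !inE oA andbF.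
(* Since [W :\ g] is connected, [Z] has an edge leaving [K :\ g] there, and this edge can only end
   in [A]. *)
have [g' g'Z [a ha rga]] := component_exit (conn_del gW) sKgW zKg oWg oKg.
have aA : a \in A.
  by move: ha; rewrite !inE; case: (a \in A) => //; case: (a == g); case: (a \in W).
have g'Kg : g' \in K :\ g := subsetP (component_sub zKg) _ g'Z.
have g'K : g' \in K by case/setD1P: g'Kg.
have g'good : ~~ bad g' by apply: (noadj a); rewrite // r_sym.
have g'k : k \in K :\ g'.
  by rewrite in_setD1 kK andbT; apply: contraNneq kZ => ->.
set Y := component (K :\ g') k.
have sYK' : Y \subset K :\ g' := component_sub g'k.
have sYK : Y \subset K := subset_trans sYK' (subsetDl _ _).
(* If [g'] also cuts some bad [z'] off from [k], the part cut off lies in [Z] and misses [g'], so it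
   is strictly smaller. *)
have [/exists_inP[z' z'K /andP[bz' z'Y]]|] :=
  boolP [exists z' in K :\ g', bad z' && (z' \notin Y)].
  apply: (IHm g' z') => //.
    by apply: contra z'Y => kC; rewrite /Y (component_eq kC) component_refl.
  (* All components of [K :\ g] other than [Z] hang together through [g], and [g'] is not among
     their nodes. *)
  have sKZY : K :\: Z \subset Y.
    apply: conn_sub_comp; last by rewrite inE kZ.
      have gKZ : g \in K :\: Z.
        rewrite inE gK andbT; apply/negP => /(subsetP (component_sub zKg)).
        by rewrite !inE eqxx.
      apply: (conn_hub (conn_set1 g)); first by rewrite sub1set.
      move=> x /setDP[xK xZ] /set1P xg.
      have xKg : x \in K :\ g by rewrite in_setD1 xK andbT; apply/eqP.
      have [y yC ryg] := component_exit1 cK gK xKg.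
      exists (component (K :\ g) x).
        rewrite conn_comp // component_refl; split=> //; apply/subsetP=> u uC.
        rewrite inE (component_disjoint xZ uC) /=.
        by have:= subsetP (component_sub xKg) u uC; rewrite inE => /andP[].
      by exists y => //; exists g => //; apply: set11.
    apply/subsetP=> x /setDP[xK xZ]; rewrite in_setD1 xK andbT.
    by apply: contraNneq xZ => ->.
  rewrite -ltnS; apply: leq_trans leZ; apply: proper_card.
  apply/properP; split; last first.
    by exists g' => //; apply/negP=> /(subsetP (component_sub z'K)); rewrite !inE eqxx.
  apply/subsetP=> x xC; have xY := component_disjoint z'Y xC.
  have xK : x \in K by have:= subsetP (component_sub z'K) x xC; rewrite inE => /andP[].
  by apply: contraR xY => xZ; apply: (subsetP sKZY); rewrite inE xZ.
(* Now every bad node of [K] lies in [Y], so [A] may grow to [W :\: Y], which takes in [g'] and the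
   other components of [K :\ g']. *)
rewrite negb_exists_in => /forall_inP noz.
have eqY : W :\: (W :\: Y) = Y.
  rewrite setDDr setDv set0U; apply/setIidPr.
  exact: subset_trans sYK (subsetDl _ _).
apply: (IHn (W :\: Y)).
- rewrite eqY -ltnS; apply: leq_trans leA; apply: proper_card.
  apply/properP; split=> //; exists g' => //.
  by apply/negP=> /(subsetP sYK'); rewrite !inE eqxx.
- apply: (subset_trans sOA); apply/subsetP=> x xA; rewrite inE (subsetP sAW) // andbT.
  by apply/negP=> /(subsetP sYK); rewrite inE xA.
- exact: subsetDl.
- have sAWY : A \subset W :\: Y.
    apply/subsetP=> x xA; rewrite inE (subsetP sAW) // andbT.
    by apply/negP=> /(subsetP sYK); rewrite inE xA.
  have g'Y : g' \in W :\: Y.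
    rewrite inE; case/setDP: g'K => -> _; rewrite andbT.
    by apply/negP=> /(subsetP sYK'); rewrite !inE eqxx.
  have cA' : conn (A :|: [set g']).
    by apply: (connU cA (conn_set1 g') aA (set11 _)).
  apply: (conn_hub cA'); first by rewrite subUset sAWY sub1set.
  move=> x /setDP[xW xY]; rewrite in_setU in_set1 negb_or => /andP[xA xg].
  have xK : x \in K :\ g' by rewrite !inE xg xA.
  have [y yC ryg] := component_exit1 cK g'K xK.
  exists (component (K :\ g') x); last first.
    by exists y => //; exists g' => //; rewrite !inE eqxx orbT.
  rewrite conn_comp // component_refl; split=> //; apply/subsetP=> u uC.
  rewrite inE (component_disjoint xY uC) /=.
  by have:= subsetP (component_sub xK) u uC; rewrite !inE => /andP[_ /andP[]].
- by rewrite eqY; apply: conn_comp.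
- by rewrite inE component_refl.
- move=> x /setDP[/setDP[xW xY] xO].
  have [xA|xA] := boolP (x \in A); first by apply: gA; rewrite inE xO.
  have [->|xg] := eqVneq x g'; first exact: g'good.
  have xK : x \in K :\ g' by rewrite !inE xg xA.
  by move: (noz x xK); rewrite xY andbT.
Qed.

(** Take the set [A] found for [O], the complement of [X], and its node [a] next to the bad node
    [f]. If [a] is in [O], let [B] be empty; otherwise let [B] be the component of [a] in
    [A :\: O]. *)
Lemma select_block X o k : X \subset W -> conn X -> conn (W :\: X) ->
    o \in W :\: X -> k \in X -> r o k -> [exists z in X, bad z] ->
  exists B f, [/\ B \subset X /\ {in B, forall x, ~~ bad x},
      conn B /\ conn (X :\: B), conn (W :\: B) /\ conn (W :\: (X :\: B)),
      f \in X :\: B /\ bad f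
    & exists2 a, (a \in W :\: X) && (B == set0) || (a \in B) & r a f].
Proof.
move=> sXW cX cO oO kX rok badX.
have eqX : W :\: (W :\: X) = X by rewrite setDDr setDv set0U; apply/setIidPr.
have [] := @select_bond (W :\: X) o k; rewrite ?eqX //; first exact: subsetDl.
move=> A [[sOA sAW] [cA cK] kA gA [a aA [f fK /andP[bf raf]]]].
have inA x : x \in A -> x \notin W :\: X -> x \in X.
  by move=> xA; rewrite inE (subsetP sAW) // andbT negbK.
have fX : f \in X.
  case/setDP: fK => fW fA; have : f \notin W :\: X by apply: contra fA; apply/subsetP.
  by rewrite inE fW andbT negbK.
have fA : f \notin A by case/setDP: fK.
have [aO|aO] := boolP (a \in W :\: X).
  exists set0, f; rewrite !setD0; split=> //.
  - by split; [apply: sub0set | move=> x; rewrite inE].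
  - by split; rewrite ?conn_set0.
  - split=> //.
    have -> : W = X :|: (W :\: X).
      by apply/setP=> x; rewrite !inE; have := subsetP sXW x; case: (x \in X) => //= ->.
    exact: connU cX cO kX oO rok.
  by exists a => //; rewrite aO eqxx.
set S := A :\: (W :\: X); have aS : a \in S by rewrite inE aO.
have sSX : S \subset X by apply/subsetP=> x /setDP[]; apply: inA.
set B := component S a; have sBS : B \subset S := component_sub aS.
have sBX := subset_trans sBS sSX.
have [y yB [o' hO' ryo']] : exists2 y, y \in B & exists2 k', k' \in A :\: S & r y k'.
  apply: (component_exit (k := o) cA) => //; first exact: subsetDl.
    exact: (subsetP sOA).
  by rewrite inE oO.
have o'O : o' \in W :\: X.
  by case/setDP: hO' => oA'; rewrite inE oA' andbT negbK.
have kB : k \notin B.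
  by apply/negP=> /(subsetP sBS); rewrite inE (negPf kA) andbF.
have kXB : k \in X :\: B by rewrite inE kB.
have fB : f \notin B by apply: contra fA => /(subsetP sBS) /setDP[].
have sKX : W :\: A \subset X.
  apply/subsetP=> x /setDP[xW xA].
  have : x \notin W :\: X by apply: contra xA; apply/subsetP.
  by rewrite inE xW andbT negbK.
(* The other components of [S] are attached to the connected set [W :\: A], because [X] is
   connected. *)
have cXB : conn (X :\: B).
  apply: (conn_hub cK).
    apply/subsetP=> x xK; rewrite inE (subsetP sKX) // andbT.
    by apply/negP => /(subsetP sBS) /setDP[xA _]; case/setDP: xK; rewrite xA.
  move=> x /setDP[xX xB] xK.
  have xA : x \in A by apply: contraR xK => xA; rewrite inE xA (subsetP sXW).
  have xS : x \in S by rewrite inE xA andbT inE xX.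
  have fS : f \notin S by apply: contra fA => /setDP[].
  have [y' y'C [k' hk' ryk]] := component_exit cX sSX xS fX fS.
  exists (component S x); last first.
    exists y' => //; exists k' => //; case/setDP: hk' => kX' kS'.
    rewrite inE (subsetP sXW) // andbT; apply: contra kS' => kA'.
    by rewrite inE kA' andbT inE kX'.
  rewrite conn_comp // component_refl; split=> //; apply/subsetP=> u uC.
  by rewrite inE (component_disjoint xB uC) (subsetP sSX) // (subsetP (component_sub xS)).
have inW u : u \in X -> u \in W by apply/subsetP.
have caseX x : (x \in B) && (x \in X) && (x \in W)
    || (x \notin B) && ((x \in X) ==> (x \in W)).
  have [xB|xB] /= := boolP (x \in B); first by rewrite inW (subsetP sBX).
  by apply/implyP; apply: inW.
exists B, f; split.
- split=> // x /(subsetP sBS); exact: gA.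
- by split=> //; apply: conn_comp.
- split.
    (* The edge between [k] and [o] joins the two parts, as [k] is outside [B]. *)
    have -> : W :\: B = (X :\: B) :|: (W :\: X).
      apply/setP=> x; rewrite in_setU !in_setD; move: (caseX x).
      by case: (x \in B); case: (x \in X); case: (x \in W).
    exact: connU cXB cO kXB oO rok.
  have -> : W :\: (X :\: B) = (W :\: X) :|: B.
    apply/setP=> x; rewrite in_setD in_setU !in_setD; move: (caseX x).
    by case: (x \in B); case: (x \in X); case: (x \in W).
  apply: (connU cO _ o'O yB ryo'); exact: conn_comp.
- by rewrite inE fB.
by exists a => //; rewrite component_refl orbT.
Qed.

End Selection.
End Connectivity.

Arguments component_sub {N r X x}.

(** * Faces and the dual graph *)

Section Faces.
Variables (V : finType) (G : embedded_graph V).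
Implicit Types (x y z : V) (d : V * V) (h k : {set V * V}) (X : {set {set V * V}}).

Definition flip d : V * V := (d.2, d.1).
(** The values of [rot] off the darts are arbitrary; the identity there makes this an injection on
    all pairs, so that faces are its orbits. *)
Definition fstep d : V * V := if d \in darts G then face_step G d else d.
Definition face_of d : {set V * V} := [set d' | fconnect fstep d d'].
Definition dual_adj h k := [exists d in h, flip d \in k].

Lemma flipK : involutive flip.
Proof. by case. Qed.

Lemma dartE d : (d \in darts G) = adj G d.1 d.2.
Proof. by rewrite inE. Qed.

Lemma flip_dart d : (flip d \in darts G) = (d \in darts G).
Proof. by rewrite !dartE adj_sym. Qed.

Lemma face_step_dart d : d \in darts G -> face_step G d \in darts G.
Proof. by rewrite !dartE adj_sym; apply: rot_adj. Qed.

Lemma fstep_dart d : (fstep d \in darts G) = (d \in darts G).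
Proof. by rewrite /fstep; case: ifP => // /face_step_dart->. Qed.

Lemma fstepE d : d \in darts G -> fstep d = face_step G d.
Proof. by rewrite /fstep => ->. Qed.

(** By transitivity each neighbour [z] is reached again from its successor, so the map is onto a
    finite set and hence injective. *)
Lemma rot_inj x : {in [set y | adj G x y] &, injective (Defs.rot G x)}.
Proof.
apply/imset_injP; rewrite eqn_leq leq_imset_card /=.
apply/subset_leq_card/subsetP => z; rewrite inE => xz.
have /iter_findex := rot_trans (rot_adj xz) xz.
set n := findex _ _ _; rewrite -iterSr iterS => e.
apply/imsetP; exists (iter n (Defs.rot G x) z) => //.
by rewrite inE; elim: n {e} => //= n; apply: rot_adj.
Qed.

Lemma fstep_inj : injective fstep.
Proof.
move=> d d' e; have := fstep_dart d; rewrite e fstep_dart.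
case: (boolP (d \in darts G)) => dG d'G; last first.
  by move: e; rewrite /fstep (negPf dG) d'G.
move: e; rewrite !fstepE // /face_step => -[e2 er].
have e1 : d.1 = d'.1.
  apply: (@rot_inj d'.2); last by rewrite -{1}e2 er.
    by rewrite inE -e2 adj_sym -dartE.
  by rewrite inE adj_sym -dartE.
by case: d d' e1 e2 {dG d'G er} => a b [a' b'] /= -> ->.
Qed.

Lemma fstep_sym : connect_sym (frel fstep).
Proof. exact: fconnect_sym fstep_inj. Qed.

Lemma face_of_refl d : d \in face_of d.
Proof. by rewrite inE. Qed.

Lemma face_of_eq d d' : d' \in face_of d -> face_of d' = face_of d.
Proof.
rewrite inE => c; apply/setP=> e; rewrite !inE.
exact/esym/(same_connect fstep_sym).
Qed.

Lemma face_of_fstep d : face_of (fstep d) = face_of d.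
Proof. by apply: face_of_eq; rewrite inE fconnect1. Qed.

Lemma face_of_step d : d \in darts G -> face_of (face_step G d) = face_of d.
Proof. by move=> dG; rewrite -fstepE // face_of_fstep. Qed.

Lemma face_of_dart d d' : d' \in face_of d -> (d' \in darts G) = (d \in darts G).
Proof.
rewrite inE => /connectP[p].
elim: p d => [|e p IH] d /=; first by move=> _ ->.
by case/andP=> /eqP<- ep l; rewrite (IH _ ep l) fstep_dart.
Qed.

Lemma face_atE d : d \in darts G -> face_at G G d = face_of d.
Proof.
move=> dG; apply/setP=> d'; rewrite !inE.
have linkE e e' : e \in darts G -> face_link G G e e' = (fstep e == e').
  by move=> eG; rewrite /face_link inE eG /= orbF fstepE // eq_sym.
apply/connectP/connectP => -[p].
  elim: p d dG => [|e p IH] d dG /=; first by move=> _ ->; exists [::].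
  rewrite linkE // => /andP[/eqP<- ep] l.
  have [|q eq lq] := IH _ _ ep l; first by rewrite fstep_dart.
  by exists (fstep d :: q) => //=; rewrite eqxx.
elim: p d dG => [|e p IH] d dG /=; first by move=> _ ->; exists [::].
case/andP=> /eqP<- ep l.
have [|q eq lq] := IH _ _ ep l; first by rewrite fstep_dart.
by exists (fstep d :: q) => //=; rewrite linkE ?eqxx.
Qed.

Lemma facesP h : reflect (exists2 d, d \in darts G & h = face_of d) (h \in faces G G).
Proof.
apply: (iffP imsetP) => -[d dG ->]; exists d => //; last exact/esym/face_atE.
exact: face_atE.
Qed.

Lemma face_of_faces d : d \in darts G -> face_of d \in faces G G.
Proof. by move=> dG; apply/facesP; exists d. Qed.

Lemma face_dart h d : h \in faces G G -> d \in h -> d \in darts G.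
Proof. by case/facesP=> e eG -> /face_of_dart->. Qed.

Lemma face_eq h d : h \in faces G G -> d \in h -> h = face_of d.
Proof. by case/facesP=> e eG -> /face_of_eq->. Qed.

Lemma dual_adj_sym : symmetric dual_adj.
Proof.
move=> h k; apply/exists_inP/exists_inP => -[d dh dk];
  by exists (flip d); rewrite ?flipK.
Qed.

Lemma dual_adj_flip d : dual_adj (face_of d) (face_of (flip d)).
Proof. by apply/exists_inP; exists d; rewrite face_of_refl. Qed.

(** Turning around [x] is a walk in the dual: crossing the edge [xy] leads to the face of [(y, x)],
    whose next dart is [(x, rot G x y)]. *)
Lemma star_connect x y z : adj G x y -> adj G x z ->
  connect (induced dual_adj (faces G G)) (face_of (x, y)) (face_of (x, z)).
Proof.
move=> xy xz; case/connectP: (rot_trans xy xz) => p.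
elim: p y xy => [|u p IH] y xy /=; first by move=> _ <-.
case/andP=> /eqP<- yp l; apply: connect_trans (IH _ (rot_adj xy) yp l).
have yx : (y, x) \in darts G by rewrite dartE adj_sym.
have -> : (x, Defs.rot G x y) = face_step G (y, x) by [].
rewrite face_of_step //; apply: connect1.
by rewrite /induced (dual_adj_flip (x, y)) !face_of_faces // dartE.
Qed.

Lemma dual_connected : connected G -> conn dual_adj (faces G G).
Proof.
move=> cG; have [F0|[h hF]] := set_0Vmem (faces G G).
  by rewrite F0 conn_set0.
have [d dG _] := facesP _ hF.
pose c := connect (induced dual_adj (faces G G)).
have main x : x \in verts G -> forall y, adj G x y -> c (face_of d) (face_of (x, y)).
  have d1 : d.1 \in verts G by apply: (@adj_verts _ _ _ d.2); rewrite -dartE.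
  move=> xG; move: cG => /forall_inP/(_ _ d1)/forall_inP/(_ _ xG)/connectP[p].
  have : forall y, adj G d.1 y -> c (face_of d) (face_of (d.1, y)).
    move=> y dy; rewrite {1}[d]surjective_pairing.
    by apply: star_connect => //; rewrite -dartE.
  elim: p (d.1) => [|v p IH] u hu /=; first by move=> _ ->.
  case/andP=> uv vp l; apply: (IH v) => // y vy.
  apply: connect_trans (hu v uv) _.
  have uvG : (u, v) \in darts G by rewrite dartE.
  apply: (@connect_trans _ _ (face_of (v, u))).
    by apply: connect1; rewrite /induced (dual_adj_flip (u, v)) !face_of_faces ?(flip_dart (u, v)).
  by apply: star_connect => //; rewrite adj_sym.
apply: (@conn_root _ _ dual_adj_sym _ (face_of d)) => k /facesP[e eG ->].
rewrite [e]surjective_pairing; apply: main; last by rewrite -dartE.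
by apply: (@adj_verts _ _ _ e.2); rewrite -dartE.
Qed.

Definition edge d : {set V} := [set d.1; d.2].

Lemma edge_flip d : edge (flip d) = edge d.
Proof. by rewrite /edge setUC. Qed.

Lemma edge_edges d : d \in darts G -> edge d \in edges G.
Proof. by move=> dG; apply/imsetP; exists d; rewrite // inE -dartE. Qed.

Lemma edgesP e : reflect (exists2 d, d \in darts G & e = edge d) (e \in edges G).
Proof.
by apply: (iffP imsetP) => -[d dG ->]; exists d;
  rewrite // inE -?dartE // dartE in dG *.
Qed.

Lemma dart_neq d : d \in darts G -> d.1 != d.2.
Proof. by rewrite dartE; apply: contraTneq => ->; rewrite adj_irr. Qed.

Lemma edge_eq d d' : d \in darts G -> (edge d' == edge d) = (d' == d) || (d' == flip d).
Proof.
move=> /dart_neq; case: d d' => [a b] [a' b'] /= nab; apply/eqP/orP; last first.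
  by case=> /eqP->; rewrite ?edge_flip.
rewrite /edge /= => e.
have := set21 a b; have := set22 a b; have := set21 a' b'; have := set22 a' b'.
rewrite {1 2}e -{3 4}e !inE !xpair_eqE => /orP[]/eqP-> /orP[]/eqP->;
  rewrite ?eqxx ?(eq_sym b) ?(negPf nab) ?orbF ?orbT //=; by auto.
Qed.

(** The face step permutes the darts of [h], and the tail of the next dart is the head of the
    present one. *)
Lemma sum_face_head (R : nmodType) (F : V -> R) h : h \in faces G G ->
  (\sum_(d in h) F d.2 = \sum_(d in h) F d.1)%R.
Proof.
move=> hF; rewrite [RHS](reindex_inj fstep_inj) /=.
apply: eq_big => [d|d dh].
  apply/idP/idP => dh; have := face_of_fstep d.
    by rewrite -(face_eq hF dh) => <-; apply: face_of_refl.
  by rewrite -(face_eq hF dh) => ->; apply: face_of_refl.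
by rewrite fstepE // (face_dart hF dh).
Qed.

End Faces.

(** * Exactness over F_2 *)

Section Cocycles.
Variables (V : finType) (G : embedded_graph V).
Implicit Types (x y z : V) (d : V * V) (h k : {set V * V}) (X : {set {set V * V}}).
Local Open Scope ring_scope.

Lemma F2_double (a : 'F_2) : a + a = 0.
Proof. by case: a => -[|[|]] //= i; apply/val_inj. Qed.

Lemma F2_eq (a b : 'F_2) : a + b = 0 -> a = b.
Proof. by move=> e; rewrite -[a]addr0 -(F2_double b) addrA e add0r. Qed.

Lemma sum_enum_val (R : nmodType) (T : finType) (A : {set T}) (F : T -> R) :
  \sum_(j < #|A|) F (enum_val j) = \sum_(x in A) F x.
Proof. exact: (esym (big_enum_val (A := mem A) F)). Qed.

Lemma sum_pick (T : finType) (A : {set T}) (F : T -> 'F_2) a : a \in A ->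
  \sum_(j < #|A|) F (enum_val j) * (a == enum_val j)%:R = F a.
Proof.
move=> aA; rewrite (sum_enum_val A (fun e => F e * (a == e)%:R)) (bigD1 a) //=.
rewrite eqxx mulr1 big1 ?addr0 // => i /andP[_ ia].
by rewrite eq_sym (negPf ia) mulr0.
Qed.

Lemma sum_mem2 (A : {set V}) (F : V -> 'F_2) x y : x \in A -> y \in A -> x != y ->
  \sum_(i in A) F i * (i \in [set x; y])%:R = F x + F y.
Proof.
move=> xA yA xy; rewrite (bigD1 x) //= (bigD1 y) /=; last by rewrite yA eq_sym.
rewrite set21 set22 !mulr1 big1 ?addr0 ?addrA // => i /andP[/andP[_ ix] iy].
by rewrite !inE (negPf ix) (negPf iy) mulr0.
Qed.

Lemma rank_left_kernel m n (A : 'M['F_2]_(m, n)) :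
    (forall u : 'rV_m, u *m A = 0 -> forall i j, u 0 i = u 0 j) ->
  (m <= (\rank A).+1)%N.
Proof.
move=> hc; suff : (\rank (kermx A) <= 1)%N by rewrite mxrank_ker; lia.
suff s : (kermx A <= (const_mx 1 : 'rV_m))%MS.
  exact: leq_trans (mxrankS s) (rank_leq_row _).
apply/row_subP=> i; set u := row i _.
have uA : u *m A = 0 by rewrite -row_mul mulmx_ker row0.
have -> : u = u 0 i *: const_mx 1.
  by apply/rowP=> j; rewrite !mxE mulr1; have := hc u uA j i; rewrite !mxE.
exact: scalemx_sub.
Qed.

(** The boundary matrices of the cell complex mod 2. An entry of [Fm] counts the sides of an edge on
    a face, so an edge with both sides on one face gives 0. *)
Let Dm : 'M['F_2]_(#|verts G|, #|edges G|) :=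
  \matrix_(i < #|verts G|, j < #|edges G|) (enum_val i \in (enum_val j : {set V}))%:R.
Let Fm : 'M['F_2]_(#|edges G|, #|faces G G|) :=
  \matrix_(j < #|edges G|, k < #|faces G G|)
    \sum_(d in (enum_val k : {set V * V})) (edge d == enum_val j)%:R.

Lemma dart_verts d : d \in darts G -> (d.1 \in verts G) && (d.2 \in verts G).
Proof.
by rewrite dartE => a; rewrite (adj_verts a); rewrite adj_sym in a; rewrite (adj_verts a).
Qed.

Lemma mul_Dm (p : V -> 'F_2) d : d \in darts G ->
  \sum_(i < #|verts G|) p (enum_val i) * (enum_val i \in edge d)%:R = p d.1 + p d.2.
Proof.
move=> dG; rewrite (sum_enum_val (verts G) (fun x => p x * (x \in edge d)%:R)).
by have /andP[a b] := dart_verts dG; rewrite sum_mem2 // (dart_neq dG).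
Qed.

Lemma mul_Fm (w : {set V} -> 'F_2) h : h \in faces G G ->
  \sum_(j < #|edges G|) w (enum_val j) * \sum_(d in h) (edge d == enum_val j)%:R
   = \sum_(d in h) w (edge d).
Proof.
move=> hF; under eq_bigr do rewrite mulr_sumr.
rewrite exchange_big; apply: eq_bigr => d dh; rewrite sum_pick //.
exact: edge_edges (face_dart hF dh).
Qed.

Lemma sum_face_mem u h : h \in faces G G ->
  (\sum_(d in h) (u \in edge d)%:R = 0 :> 'F_2).
Proof.
move=> hF; transitivity (\sum_(d in h) ((d.1 == u)%:R + (d.2 == u)%:R : 'F_2)).
  apply: eq_bigr => d dh; have := dart_neq (face_dart hF dh).
  rewrite !inE !(eq_sym u); have [<-|_ _] := eqVneq d.1 u; last by rewrite add0r.
  by rewrite eq_sym => /negPf->; rewrite addr0.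
by rewrite big_split /= (sum_face_head (G := G) (fun y => (y == u)%:R)) // F2_double.
Qed.

Lemma mul_DF : Dm *m Fm = 0.
Proof.
apply/matrixP=> i k; rewrite !mxE.
under eq_bigr do rewrite !mxE.
rewrite (@mul_Fm (fun e => (enum_val i \in e)%:R)); last exact: enum_valP.
exact: sum_face_mem (enum_valP k).
Qed.

Lemma rank_Dm : connected G -> (#|verts G| <= (\rank Dm).+1)%N.
Proof.
move=> cG; apply: rank_left_kernel => u uD i j.
pose p x : 'F_2 := u 0 (enum_rank_in (enum_valP i) x).
have pE l : u 0 l = p (enum_val l) by rewrite /p enum_valK_in.
have stp x y : adj G x y -> p x = p y.
  move=> xy; have dG : (x, y) \in darts G by rewrite dartE.
  apply: F2_eq; rewrite -(mul_Dm p dG).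
  have eE := edge_edges dG.
  have /rowP/(_ (enum_rank_in eE (edge (x, y)))) := uD.
  rewrite !mxE => eq0; rewrite -[RHS]eq0.
  by apply: eq_bigr => k _; rewrite !mxE enum_rankK_in // pE.
rewrite !pE; have iG := enum_valP i; have jG := enum_valP j.
case/connectP: (forall_inP (forall_inP cG _ iG) _ jG) => q.
elim: q (enum_val i) => [|v q IH] x /=; first by move=> _ ->.
by case/andP=> /stp-> /IH.
Qed.

(** A function on the faces killed by the transpose agrees on the two sides of every edge, hence is
    constant because the dual is connected. *)
Lemma rank_Fm : connected G -> (#|faces G G| <= (\rank Fm).+1)%N.
Proof.
move=> cG; rewrite -mxrank_tr; apply: rank_left_kernel => u uF i j.
pose p h : 'F_2 := u 0 (enum_rank_in (enum_valP i) h).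
have pE l : u 0 l = p (enum_val l) by rewrite /p enum_valK_in.
have stp d : d \in darts G -> p (face_of G d) = p (face_of G (flip d)).
  move=> dG; apply: F2_eq.
  have eE := edge_edges dG.
  have /rowP/(_ (enum_rank_in eE (edge d))) := uF.
  rewrite !mxE => eq0; rewrite -[RHS]eq0.
  transitivity (\sum_(d' in darts G) p (face_of G d') * (edge d' == edge d)%:R).
    have nf : flip d != d.
      by case: d dG {eE eq0} => a b /dart_neq /=; rewrite /flip xpair_eqE eq_sym => /negPf->.
    rewrite (bigD1 d) //= (bigD1 (flip d)) ?flip_dart ?dG //=.
    rewrite edge_flip eqxx !mulr1 big1 ?addr0 // => d' /andP[/andP[_ n1] n2].
    by rewrite (edge_eq _ dG) (negPf n1) (negPf n2) mulr0.
  rewrite (partition_big (face_of G) (mem (faces G G))) /=;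
    last by move=> d'; apply: face_of_faces.
  rewrite -sum_enum_val; apply: eq_bigr => k _.
  rewrite !mxE enum_rankK_in // pE mulr_sumr; have kF := enum_valP k.
  apply: eq_big => [d'|d' /andP[_ /eqP->]] //.
  apply/andP/idP => [[_ /eqP<-]|dh]; first exact: face_of_refl.
  by rewrite (face_dart kF dh) (face_eq kF dh).
rewrite !pE; have iF := enum_valP i; have jF := enum_valP j.
apply/esym/eqP.
apply: (@conn_ind _ _ _ (fun h => p h == p (enum_val i)) _ (dual_connected cG) iF) => //.
move=> h k hF kF /exists_inP[d dh fk] /eqP<-; have dG := face_dart hF dh.
by rewrite (face_eq hF dh) (face_eq kF fk) -stp.
Qed.

(** A dimension count: the kernel of [Fm] has rank at most e - (f - 1), which is v - 1 by Euler's
    formula, and its subspace spanned by [Dm] has rank at least v - 1. *)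
Lemma cocycle_coboundary (w : {set V} -> 'F_2) : plane G ->
    (forall h, h \in faces G G -> \sum_(d in h) w (edge d) = 0) ->
  exists p : V -> 'F_2, forall x y, adj G x y -> w [set x; y] = p x + p y.
Proof.
move=> [cG euler] hw.
have sDF : (Dm <= kermx Fm)%MS by apply/sub_kermxP; apply: mul_DF.
have sFD : (kermx Fm <= Dm)%MS.
  rewrite -(mxrank_leqif_sup sDF) mxrank_ker.
  have := rank_Dm cG; have := rank_Fm cG; have := mxrankS sDF.
  by rewrite mxrank_ker; move: euler; rewrite /nb_verts /nb_edges; 
     move: (\rank Dm) (\rank Fm) => a b; lia.
pose W : 'rV_#|edges G| := \row_j w (enum_val j).
have : (W <= kermx Fm)%MS.
  apply/sub_kermxP/rowP=> k; rewrite !mxE.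
  under eq_bigr do rewrite !mxE.
  by rewrite mul_Fm ?hw //; apply: enum_valP.
move=> /submx_trans/(_ sFD)/submxP[u eW].
pose p x : 'F_2 := oapp (fun i => u 0 i) 0 [pick i | enum_val i == x].
exists p => x y xy.
have dG : (x, y) \in darts G by rewrite dartE.
have eE := edge_edges dG.
rewrite -[RHS](mul_Dm p dG); have /rowP/(_ (enum_rank_in eE (edge (x, y)))) := eW.
rewrite !mxE enum_rankK_in // => ->.
apply: eq_bigr => k _; rewrite !mxE enum_rankK_in //.
rewrite /p; case: pickP => [k' /eqP/enum_val_inj->//|/(_ k)]; by rewrite eqxx.
Qed.

End Cocycles.

(** * The dual of a 2-connected plane graph *)

Section TwoConnected.
Variables (V : finType) (G : embedded_graph V).
Implicit Types (x y z : V) (d : V * V) (h k : {set V * V}) (X : {set {set V * V}}).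
Hypotheses (planeG : plane G) (twoG : two_connected G).

Let conG : connected G := planeG.1.

Lemma connected_del1 u x y : u \in verts G -> x \in verts G -> y \in verts G ->
  x != u -> y != u -> connect (del_adj G [set u]) x y.
Proof.
move=> uG xG yG xu yu.
have : connected (del_verts G [set u]) by apply: twoG.2; rewrite ?sub1set ?cards1.
by move=> /forall_inP/(_ x)/=; rewrite !inE xu xG => /(_ isT)/forall_inP/(_ y); 
   rewrite !inE yu yG => /(_ isT).
Qed.

Lemma third_vertex x y : exists2 z, z \in verts G & (z != x) && (z != y).
Proof.
have [/subsetP s|/subsetPn[z zG]] := boolP (verts G \subset [set x; y]); last first.
  by rewrite !inE negb_or => zxy; exists z.
have : #|verts G| <= #|[set x; y]| by apply/subset_leq_card/subsetP.
by rewrite cards2 leqNgt (leq_ltn_trans _ twoG.1) //; case: (_ != _).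
Qed.

Lemma second_neighbour x y : x \in verts G -> y != x -> exists2 z, adj G x z & z != y.
Proof.
move=> xG yx; have [w wG /andP[wx wy]] := third_vertex x y.
have [yG|yG] := boolP (y \in verts G); last first.
  case/connectP: (forall_inP (forall_inP conG _ xG) _ wG) => -[|z p] /=.
    by move=> _ wE; rewrite wE eqxx in wx.
  case/andP=> xz _ _; exists z => //; apply: contraNneq yG => <-.
  by apply: (@adj_verts _ _ _ x); rewrite adj_sym.
have xy : x != y by rewrite eq_sym.
case/connectP: (connected_del1 yG xG wG xy wy) => -[|z p] /=.
  by move=> _ wE; rewrite wE eqxx in wx.
case/andP=> /and3P[xz _ zy] _ _; exists z => //.
by rewrite inE in zy.
Qed.

Lemma dual_del g : g \in faces G G -> conn (@dual_adj V) (faces G G :\ g).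
Proof.
move=> gF; apply/connP => k0 k1 k0F k1F.
set W := faces G G :\ g in k0F k1F *.
apply: contraT => nk1.
pose P := component (@dual_adj V) W k0.
have k0P : k0 \in P by apply: component_refl.
have k1P : k1 \notin P by rewrite inE.
have PF h : h \in P -> h \in W by apply/subsetP; apply: component_sub.
have PW h k : h \in P -> k \in faces G G -> k != g -> dual_adj h k -> k \in P.
  move=> hP kF kg hk; apply: (component_closed _ hP) => //.
  by rewrite !inE kg.
(* R d: the edge of d lies on a face of P.  The function w u is the indicator of
   these edges at u; each visit of a face of P to u uses two of them, and the sum
   around g vanishes because the sum over all faces does. *)
pose R d := (face_of G d \in P) || (face_of G (flip d) \in P).
have R_flip d : R (flip d) = R d by rewrite /R flipK orbC.
pose RE := [set edge d | d in darts G & R d].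
have RE_edge d : d \in darts G -> (edge d \in RE) = R d.
  move=> dG; apply/imsetP/idP => [[d']|Rd]; last by exists d; rewrite // !inE -?dartE ?dG.
  rewrite inE => /andP[d'G Rd'] /eqP; rewrite (edge_eq _ d'G).
  by case/orP=> /eqP->; rewrite ?R_flip.
have R_face h d : h \in P -> d \in h -> R d.
  move=> hP dh; have /setD1P[_ hF] := PF h hP.
  by rewrite /R -(face_eq hF dh) hP.
(* A face other than [g] that shared an edge with a face of [P] would belong to the component
   [P]. *)
have nR_face h d : h \in faces G G -> h != g -> h \notin P -> d \in h -> ~~ R d.
  move=> hF hg hP dh; have hE := face_eq hF dh; rewrite /R -hE (negPf hP) /=.
  apply: contra hP => fP; apply: (PW _ _ fP hF hg); rewrite hE dual_adj_sym.
  exact: dual_adj_flip.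
pose w u (e : {set V}) : 'F_2 := ((u \in e) && (e \in RE))%:R%R.
have wE u d : d \in darts G -> w u (edge d) = ((u \in edge d) && R d)%:R%R.
  by move=> dG; rewrite /w RE_edge.
have wP u h : h \in faces G G -> h != g -> (\sum_(d in h) w u (edge d) = 0)%R.
  move=> hF hg; have [hP|hP] := boolP (h \in P).
    rewrite -[RHS](sum_face_mem u hF); apply: eq_bigr => d dh.
    by rewrite wE ?(face_dart hF dh) // (R_face h) // andbT.
  rewrite big1 // => d dh.
  by rewrite wE ?(face_dart hF dh) // (negPf (nR_face h d hF hg hP dh)) andbF.
have w0 u h : h \in faces G G -> (\sum_(d in h) w u (edge d) = 0)%R.
  move=> hF; have [->{h hF}|hg] := eqVneq h g; last exact: wP.
  have tot : (\sum_(d in darts G) w u (edge d) = 0)%R.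
    transitivity (\sum_(d in darts G)
        (((d.1 == u) && R d)%:R + ((d.2 == u) && R d)%:R : 'F_2))%R.
      apply: eq_bigr => d dG; rewrite wE //; have := dart_neq dG.
      rewrite !inE !(eq_sym u); have [<-|_ _] := eqVneq d.1 u; last by rewrite add0r.
      by rewrite eq_sym => /negPf->; rewrite addr0.
    rewrite big_split /= [X in (_ + X)%R](reindex_inj (inv_inj (@flipK V))) /=.
    rewrite [X in (_ + X)%R](eq_big (mem (darts G)) (fun d => ((d.1 == u) && R d)%:R))%R.
    - exact: F2_double.
    - by move=> d; rewrite flip_dart.
    - by move=> d _; rewrite R_flip.
  rewrite -[RHS]tot [RHS](partition_big (face_of G) (mem (faces G G))) /=;
    last by move=> d; apply: face_of_faces.
  have bigE h : h \in faces G G ->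
      (\sum_(d in darts G | face_of G d == h) w u (edge d) = \sum_(d in h) w u (edge d))%R.
    move=> hF; apply: eq_bigl => d; apply/andP/idP => [[_ /eqP<-]|dh]; first exact: face_of_refl.
    by rewrite (face_dart hF dh) (face_eq hF dh).
  rewrite (bigD1 g) //= bigE // [X in (_ + X)%R]big1 ?addr0 // => h /andP[hF hg].
  by rewrite bigE ?wP.
(* Write [w u] as the coboundary of [p]. It vanishes on edges avoiding [u], so [p] is constant on
   the connected graph G - u, and [w u] is constant on the edges at [u]. *)
have star u y z : adj G u y -> adj G u z -> R (u, y) = R (u, z).
  move=> uy uz; have [p hp] := cocycle_coboundary planeG (w0 u).
  have uG := adj_verts uy.
  have nbG v : adj G u v -> v \in verts G by rewrite adj_sym; apply: adj_verts.
  have nbN v : adj G u v -> v != u by apply: contraTneq => ->; rewrite adj_irr.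
  have wu v : adj G u v -> w u [set u; v] = (R (u, v))%:R%R.
    by move=> uv; rewrite -[[set u; v]]/(edge (u, v)) wE ?dartE // set21.
  suff pe : p y = p z.
    have := wu y uy; rewrite hp // pe -hp // wu //.
    by case: (R (u, y)); case: (R (u, z)) => // /eqP; rewrite ?oner_eq0 // eq_sym oner_eq0.
  have /connectP[q] := connected_del1 uG (nbG y uy) (nbG z uz) (nbN y uy) (nbN z uz).
  elim: q y {uy} => [|v q IH] y /=; first by move=> _ ->.
  case/andP=> /and3P[yv yu vu] vq l; rewrite -(IH v vq l).
  apply: F2_eq; rewrite -hp // /w !inE (eq_sym u) (eq_sym u).
  by rewrite !inE in yu vu; rewrite (negPf yu) (negPf vu).
have [d0 d0G k0E] : exists2 d, d \in darts G & k0 = face_of G d.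
  by apply/facesP; case/setD1P: k0F.
have [d1 d1G k1E] : exists2 d, d \in darts G & k1 = face_of G d.
  by apply/facesP; case/setD1P: k1F.
have R0 : R d0 by apply: (R_face k0) => //; rewrite k0E face_of_refl.
have nR1 : ~~ R d1.
  by apply: (nR_face k1) => //; try (by case/setD1P: k1F); rewrite k1E face_of_refl.
(* Along a path of [G] from [d0] to [d1] the property [R] passes from one star to the next, against
   [nR1]. *)
have dG d : d \in darts G -> d.1 \in verts G by rewrite dartE; apply: adj_verts.
case/negP: nR1; rewrite [d1]surjective_pairing.
case/connectP: (forall_inP (forall_inP conG _ (dG d0 d0G)) _ (dG d1 d1G)) => q.
have : forall y, adj G d0.1 y -> R (d0.1, y).
  by move=> y dy; rewrite (star _ _ d0.2) // -?dartE -?surjective_pairing.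
have : adj G d1.1 d1.2 by rewrite -dartE.
elim: q (d0.1) => [|v q IH] u d1a hu /=; first by move=> _ l; rewrite l in d1a *; apply: hu.
case/andP=> uv vq l; apply: (IH v) => // y vy.
by rewrite (star _ _ u) // 1?adj_sym // -R_flip; apply: hu.
Qed.

(** The boundary cannot turn back at [y]: if [rot G y] fixed [x], then [x] would be the only
    neighbour of [y]. *)
Lemma triangle_walk d : d \in darts G ->
  uniq [:: d.1; (fstep G d).1; (fstep G (fstep G d)).1].
Proof.
case: d => x y dG; have ayx : adj G y x by rewrite adj_sym -(dartE G (x, y)).
have s1 : fstep G (x, y) = (y, Defs.rot G y x) by rewrite fstepE.
have dG1 : fstep G (x, y) \in darts G by rewrite fstep_dart.
have s2 : (fstep G (fstep G (x, y))).1 = Defs.rot G y x.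
  by rewrite fstepE // s1.
rewrite s2 s1 /= !inE andbT negb_or.
have xy := dart_neq dG; have := dart_neq dG1; rewrite s1 /= in xy * => ->.
rewrite xy andbT /=; apply/eqP => rE.
have yG := adj_verts ayx.
have [z yz] := second_neighbour yG xy.
case/eqP; apply/esym.
have [n ->] : exists n, z = iter n (Defs.rot G y) x.
  by exists (findex (Defs.rot G y) x z); rewrite iter_findex // rot_trans.
by elim: n => //= n <-.
Qed.

Lemma face_card_ge3 h : h \in faces G G -> 2 < #|h|.
Proof.
case/facesP=> d dG ->; have := triangle_walk dG => u.
have <- : #|[set d; fstep G d; fstep G (fstep G d)]| = 3.
  apply/eqP; rewrite -setUA cardsU1 cards2 !inE negb_or.
  move: u; rewrite /= !inE negb_or andbT => /andP[/andP[a b] c].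
  have ne e e' : e.1 != e'.1 -> (e == e' :> V * V) = false.
    by move=> n; apply: contraNF n => /eqP->.
  by rewrite !ne.
apply/subset_leq_card/subsetP => e; rewrite !inE => /orP[/orP[]|] /eqP->.
- exact: connect0.
- exact: fconnect1.
- exact: (fconnect_iter _ 2).
Qed.

(** The first three darts have distinct tails and fill [h]; by injectivity the step from the third
    can only return to [d]. *)
Lemma triangle_face h d : h \in faces G G -> #|h| = 3 -> d \in h ->
  exists z, uniq [:: d.1; d.2; z] /\ h = [set d; (d.2, z); (z, d.1)].
Proof.
move=> hF h3 dh; have dG := face_dart hF dh; have := triangle_walk dG.
set d1 := fstep G d; set d2 := fstep G d1; move=> u.
have d1G : d1 \in darts G by rewrite fstep_dart.
have d2G : d2 \in darts G by rewrite fstep_dart.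
have e1 : d1.1 = d.2 by rewrite /d1 fstepE.
have e2 : d2.1 = d1.2 by rewrite /d2 fstepE.
have ne e e' : e.1 != e'.1 -> (e == e' :> V * V) = false.
  by move=> n; apply: contraNF n => /eqP->.
move: (u); rewrite /= !inE negb_or andbT => /andP[/andP[n1 n2] n3].
have hE : h = [set d; d1; d2].
  apply/esym/eqP; rewrite eqEcard h3 -setUA cardsU1 cards2 !inE negb_or !ne //= andbT.
  rewrite (face_eq hF dh).
  apply/subsetP => e; rewrite !inE => /orP[|/orP[]] /eqP->.
  - exact: connect0.
  - exact: fconnect1.
  - exact: (fconnect_iter _ 2).
have : fstep G d2 \in h.
  by rewrite (face_eq hF dh) inE; apply: (fconnect_iter _ 3).
have f1 : (fstep G d2 == d1) = false by rewrite (inj_eq (@fstep_inj _ G)) eq_sym ne.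
have f2 : (fstep G d2 == d2) = false by rewrite (inj_eq (@fstep_inj _ G)) eq_sym ne.
rewrite hE !inE f1 f2 !orbF => /eqP e3.
have e3' : d.1 = d2.2 by rewrite -e3 fstepE.
exists d1.2; split; first by rewrite -e1 -e2.
by rewrite {1}[d1]surjective_pairing [X in [set d; _; X]]surjective_pairing e1 e2 e3'.
Qed.

End TwoConnected.

(** * Discs of triangles are near triangulations *)

Section FaceGraph.
Variables (V : finType) (G : embedded_graph V).
Implicit Types (x y z : V) (d : V * V) (h k : {set V * V}) (X : {set {set V * V}}).

(** Tails suffice, since each head on a face is the tail of the next dart. *)
Definition verts_of X : {set V} := \bigcup_(h in X) [set d.1 | d in h].

Lemma verts_ofP X x :
  reflect (exists2 h, h \in X & exists2 d, d \in h & d.1 = x) (x \in verts_of X).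
Proof.
apply: (iffP bigcupP) => -[h hX].
  by case/imsetP=> d dh ->; exists h => //; exists d.
by case=> d dh <-; exists h => //; apply: imset_f.
Qed.

Lemma verts_of_face_of X d : d \in darts G -> face_of G d \in X ->
  (d.1 \in verts_of X) && (d.2 \in verts_of X).
Proof.
move=> dG hX; apply/andP; split; apply/verts_ofP; exists (face_of G d) => //.
  by exists d; rewrite // face_of_refl.
exists (fstep G d); first by rewrite -face_of_fstep face_of_refl.
by rewrite fstepE.
Qed.

Lemma verts_ofU X Y : verts_of (X :|: Y) = verts_of X :|: verts_of Y.
Proof. exact: bigcup_setU. Qed.

Definition face_adj X : rel V := fun x y =>
  adj G x y && ((face_of G (x, y) \in X) || (face_of G (y, x) \in X)).

Lemma face_adj_sym X : symmetric (face_adj X).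
Proof. by move=> x y; rewrite /face_adj adj_sym orbC. Qed.

Lemma face_adj_irr X : irreflexive (face_adj X).
Proof. by move=> x; rewrite /face_adj adj_irr. Qed.

Lemma face_adj_verts X x y : face_adj X x y -> x \in verts_of X.
Proof.
case/andP=> xy /orP[] h.
  have dG : (x, y) \in darts G by rewrite dartE.
  by case/andP: (verts_of_face_of dG h).
have dG : (y, x) \in darts G by rewrite dartE adj_sym.
by case/andP: (verts_of_face_of dG h).
Qed.

Definition face_graph X : graph V :=
  Graph (@face_adj_sym X) (@face_adj_irr X) (@face_adj_verts X).

Lemma face_graph_sub X : X \subset faces G G -> subgraph (face_graph X) G.
Proof.
move=> /subsetP sX; split; last by move=> x y /andP[].
apply/subsetP=> x /verts_ofP[h hX [d dh <-]].
by apply: (@adj_verts _ _ _ d.2); rewrite -dartE (face_dart (sX _ hX)).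
Qed.

Lemma face_graph_dart X d : d \in darts G ->
  (d \in darts (face_graph X)) = (face_of G d \in X) || (face_of G (flip d) \in X).
Proof. by rewrite dartE inE /= /face_adj -surjective_pairing => ->. Qed.

Lemma face_link_face_of (H : graph V) d d' : d \in darts G -> d' \in face_of G d ->
  connect (face_link G H) d d'.
Proof.
move=> dG; rewrite inE => /connectP[p].
elim: p d dG => [|e p IH] d dG /=; first by move=> _ ->.
case/andP=> /eqP<- ep l; apply: connect_trans (IH _ _ ep l); last by rewrite fstep_dart.
by apply: connect1; rewrite /face_link fstepE // eqxx.
Qed.

(** No edge of this face has been removed, so no link crosses to another face. *)
Lemma face_at_face_of (H : graph V) d : d \in darts G -> face_of G d \subset darts H ->
  face_at G H d = face_of G d.
Proof.
move=> dG /subsetP sH; apply/setP=> d'; rewrite inE.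
apply/idP/idP => [|/face_link_face_of->//].
case/connectP=> p; elim: p d dG sH => [|e p IH] d dG sH /=.
  by move=> _ ->; apply: face_of_refl.
rewrite {1}/face_link in_setD (sH _ (face_of_refl G d)) /= orbF => /andP[/eqP eE ep l].
have ee : e = fstep G d by rewrite fstepE.
rewrite -(face_of_fstep G d) -ee; apply: IH => //.
  by rewrite ee fstep_dart.
by rewrite ee face_of_fstep.
Qed.

Section Facial.
Variable C : seq V.
Hypothesis facC : facial_cycle G C.

Lemma cycle_darts_dart d : d \in cycle_darts C -> d \in darts G.
Proof.
by case: facC => _ _ cC _ /mapP[x xC ->]; rewrite dartE /=; apply: next_cycle.
Qed.

Lemma cycle_darts_face_of d d' : d \in cycle_darts C ->
  (d' \in face_of G d) = (d' \in cycle_darts C).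
Proof.
case: facC => _ _ _ fC dC; rewrite inE.
apply: (fconnect_cycle _ dC).
have eqs : {in mem (cycle_darts C) &, frel (fstep G) =2 frel (face_step G)}.
  by move=> e e' eC _ /=; rewrite fstepE // cycle_darts_dart.
by rewrite (eq_in_cycle eqs) //; apply/allP.
Qed.

Lemma cycle_darts_nonempty : exists d, d \in cycle_darts C.
Proof.
case: facC; case: C => // x s _ _ _ _.
by exists (x, next (x :: s) x); rewrite /cycle_darts map_f // mem_head.
Qed.

Lemma card_cycle_face d : d \in cycle_darts C -> #|face_of G d| = size C.
Proof.
move=> dC; case: facC => _ uC _ _.
rewrite -(size_map (fun x => (x, next C x))) -(card_uniqP _).
  by apply: eq_card => d'; rewrite cycle_darts_face_of.
by rewrite map_inj_in_uniq // => x y _ _ [].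
Qed.

Section Block.
Variable X : {set {set V * V}}.
Hypotheses (planeG : plane G) (twoG : two_connected G).
Hypotheses (sX : X \subset faces G G) (cX : conn (@dual_adj V) X).
Hypothesis tri : {in X, forall h, #|h| = 3}.

Let XF h : h \in X -> h \in faces G G.
Proof. exact: (subsetP sX). Qed.

(** After the deletion of at most one vertex each triangle stays connected, and two triangles with a
    common edge still share one of its ends; connectedness then spreads through the dual. *)
Lemma face_graph_two_connected : X != set0 -> two_connected (face_graph X).
Proof.
case/set0Pn=> h0 h0X; have [d0 d0h] : exists d, d \in h0.
  by apply/card_gt0P; rewrite tri.
split.
  have [z [u hE]] := triangle_face planeG twoG (XF h0X) (tri h0X) d0h.
  rewrite /nb_verts /=; have <- : #|[set d0.1; d0.2; z]| = 3.
    move: u; rewrite /= !inE negb_or andbT -setUA cardsU1 cards2 !inE negb_or.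
    by move=> /andP[-> ->].
  apply/subset_leq_card/subsetP => x; rewrite !inE => xE; apply/verts_ofP; exists h0 => //.
  case/orP: xE => [/orP[]|] /eqP->; 
    [exists d0 => // | exists (d0.2, z) | exists (z, d0.1)] => //;
    by rewrite hE !inE eqxx ?orbT.
move=> S _ S1.
have edgeT h d : h \in X -> d \in h -> d.1 \notin S -> d.2 \notin S ->
    connect (adj (del_verts (face_graph X) S)) d.1 d.2.
  move=> hX dh n1 n2; apply: connect1; rewrite /= /del_adj n1 n2 !andbT.
  have dG := face_dart (XF hX) dh.
  by rewrite /= /face_adj -dartE dG -surjective_pairing -(face_eq (XF hX) dh) hX.
have csym : connect_sym (adj (del_verts (face_graph X) S)).
  by apply: sym_connect_sym; apply: adj_sym.
have faceT h d e : h \in X -> d \in h -> e \in h -> d.1 \notin S -> e.1 \notin S ->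
    connect (adj (del_verts (face_graph X) S)) d.1 e.1.
  move=> hX dh eh n1 n2.
  have [z [_ hE]] := triangle_face planeG twoG (XF hX) (tri hX) dh.
  have h2 : (d.2, z) \in h by rewrite hE !inE eqxx ?orbT.
  have h3 : (z, d.1) \in h by rewrite hE !inE eqxx ?orbT.
  move: eh n2; rewrite hE !inE => /orP[/orP[]|] /eqP-> //= n2.
    exact: edgeT dh n1 n2.
  by rewrite csym; apply: (edgeT h (z, d.1)).
have [d1 d1h d1S] : exists2 d, d \in h0 & d.1 \notin S.
  have [d0S|d0S] := boolP (d0.1 \in S); last by exists d0.
  have S0 : S = [set d0.1].
    by apply/esym/eqP; rewrite eqEcard sub1set d0S cards1.
  exists (fstep G d0).
    by rewrite (face_eq (XF h0X) d0h) -face_of_fstep face_of_refl.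
  have dG := face_dart (XF h0X) d0h.
  by rewrite S0 inE fstepE //= eq_sym; apply: dart_neq dG.
pose P h := [forall d in h, (d.1 \notin S) ==>
   connect (adj (del_verts (face_graph X) S)) d1.1 d.1].
have allP : {in X, forall h, P h}.
  apply: (conn_ind cX h0X).
    by apply/forall_inP=> d dh; apply/implyP; apply: (faceT h0).
  move=> h k hX kX /exists_inP[e eh fk] /forall_inP Ph.
  apply/forall_inP=> d dk; apply/implyP=> dS.
  have [e1S|e1S] := boolP (e.1 \in S); last first.
    apply: connect_trans (implyP (Ph e eh) e1S) _.
    have fk' : fstep G (flip e) \in k.
      by rewrite (face_eq (XF kX) fk) -face_of_fstep face_of_refl.
    have ee : (fstep G (flip e)).1 = e.1 by rewrite fstepE // (face_dart (XF kX) fk).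
    by rewrite -ee; apply: (faceT k) => //; rewrite ee.
  have eh' : fstep G e \in h by rewrite (face_eq (XF hX) eh) -face_of_fstep face_of_refl.
  have ee : (fstep G e).1 = e.2 by rewrite fstepE // (face_dart (XF hX) eh).
  have e2S : e.2 \notin S.
    apply: contraL S1 => e2S; rewrite -leqNgt.
    have <- : #|[set e.1; e.2]| = 2 by rewrite cards2 (dart_neq (face_dart (XF hX) eh)).
    by apply/subset_leq_card/subsetP => x; rewrite !inE => /orP[]/eqP->.
  have := implyP (Ph _ eh'); rewrite ee => /(_ e2S) c.
  by apply: connect_trans c _; apply: (faceT k (flip e)).
suff root x : x \in verts (del_verts (face_graph X) S) ->
    connect (adj (del_verts (face_graph X) S)) d1.1 x.
  apply/forall_inP=> x xT; apply/forall_inP=> y yT.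
  by apply: connect_trans (root y yT); rewrite csym root.
case/setDP=> /verts_ofP[h hX [d dh <-]] dS.
exact: (implyP (forall_inP (allP h hX) d dh)).
Qed.

Lemma face_graph_near_triangulation :
    X != set0 -> conn (@dual_adj V) (faces G G :\: X) ->
    {in cycle_darts C, forall d, face_of G d \notin X} ->
  near_triangulation G C (face_graph X).
Proof.
move=> X0 cO outX; split; first exact: face_graph_two_connected.
move=> F /imsetP[d dG ->] {F}; have [dX|dX] := boolP (face_of G d \in X).
  have sd : face_of G d \subset darts (face_graph X).
    apply/subsetP=> e ed; rewrite face_graph_dart ?(face_of_eq ed) ?dX //.
    by rewrite (face_of_dart ed).
  rewrite face_at_face_of // => _.
  have [z [u hE]] := triangle_face planeG twoG (XF dX) (tri dX) (face_of_refl G d).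
  exists d.1, d.2, z; split=> //; rewrite /boundary_edges.
  have -> : face_of G d :&: darts (face_graph X) = face_of G d by apply/setIidPl.
  by rewrite hE !imsetU !imset_set1.
(* A face of the subgraph that comes from outside [X] contains a dart of [C], so it is the outer
   face. *)
have [dC dCC] := cycle_darts_nonempty.
case/negP; apply/hasP; exists dC => //.
suff : connect (face_link G (face_graph X)) d dC by rewrite /= inE.
have dCG := cycle_darts_dart dCC.
have dW : face_of G d \in faces G G :\: X by rewrite inE dX face_of_faces.
have dCW : face_of G dC \in faces G G :\: X by rewrite inE outX // face_of_faces.
suff /(_ _ dCW)/forall_inP : {in faces G G :\: X, forall h,
    [forall e in h, connect (face_link G (face_graph X)) d e]}.
  by move/(_ dC (face_of_refl G dC)).
apply: (conn_ind cO dW).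
  by apply/forall_inP=> e; apply: face_link_face_of.
move=> h k /setDP[hF hX] /setDP[kF kX] /exists_inP[e eh fk] /forall_inP Ph.
apply/forall_inP=> e' e'k; have eG := face_dart hF eh.
apply: connect_trans (Ph e eh) _.
apply: (@connect_trans _ _ (flip e)); last first.
  by apply: face_link_face_of; rewrite ?flip_dart // -(face_eq kF fk).
(* Neither side of the edge lies on a face of [X], so the edge is removed and may be crossed. *)
apply: connect1; rewrite /face_link in_setD eG face_graph_dart //.
by rewrite -(face_eq hF eh) -(face_eq kF fk) (negPf hX) (negPf kX) eqxx orbT.
Qed.

End Block.
End Facial.
End FaceGraph.

(** * The vertex bound for discs *)

Section Counting.
Variables (V : finType) (G : embedded_graph V).
Implicit Types (x y z : V) (d e : V * V) (h k : {set V * V}).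
Implicit Types (X Y : {set {set V * V}}).
Hypotheses (planeG : plane G) (twoG : two_connected G).
Local Notation W := (faces G G).

(** The number of diagonals that triangulate all faces of [X]; the subtraction does not truncate, as
    every face has at least three sides. *)
Definition excess X := \sum_(h in X) (#|h| - 3).

Lemma excess_sub X Y : X \subset Y -> excess X <= excess Y.
Proof. by move=> sXY; rewrite /excess [leqRHS](big_setID X) /= (setIidPr sXY) leq_addr. Qed.

Lemma excessU X Y : [disjoint X & Y] -> excess (X :|: Y) = excess X + excess Y.
Proof. by move=> dXY; rewrite /excess -bigU //; apply: eq_bigl => h; rewrite !inE. Qed.

Section Bound.
Variables (o : {set V * V}) (t : nat).
Hypotheses (oW : o \in W) (ht : 4 <= t).
Hypothesis small : forall X, X \subset W -> X != set0 -> conn (@dual_adj V) X ->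
  conn (@dual_adj V) (W :\: X) -> {in X, forall h, #|h| = 3} -> o \notin X ->
  #|verts_of X| < t.

(* L d stands for the piece beyond the edge of d, empty if there is none.  Along
   the boundary of f, every new piece shares the vertex d.2 with the later ones. *)
Section Walk.
Variables (c : nat) (f : {set V * V}) (L : V * V -> {set {set V * V}}).
Hypothesis fW : f \in W.
Hypothesis L_eq : forall d d', d \in f -> d' \in f ->
  ~~ [disjoint L d & L d'] -> L d = L d'.
Hypothesis L_edge : forall d, d \in f -> L d != set0 -> edge d \subset verts_of (L d).
Hypothesis L_bound : forall d, d \in f -> L d != set0 ->
  #|verts_of (L d)| < t + c * excess (L d).

Let P d := edge d :|: verts_of (L d).

Lemma card_walk n d : d \in f ->
  #|\bigcup_(e <- traject (fstep G) d n) P e|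
    <= 1 + n * (t - 2) + c * excess (\bigcup_(e <- traject (fstep G) d n) L e).
Proof.
elim: n d => [|n IH] d df; first by rewrite big_nil cards0.
have sdf e : e \in f -> fstep G e \in f.
  by move=> ef; rewrite (face_eq fW ef) -face_of_fstep face_of_refl.
have := IH _ (sdf d df); rewrite trajectS !big_cons.
set U := \bigcup_(e <- _) _; set Q := \bigcup_(e <- _) _ => IHd.
have dG := face_dart fW df.
have Pd : #|P d| < t + c * excess (L d).
  have [L0|L0] := eqVneq (L d) set0.
    rewrite /P L0 /verts_of big_set0 setU0 cards2.
    by apply: leq_trans (leq_addr _ _); case: (_ != _) => /=; lia.
  by rewrite /P (setUidPr _) ?L_edge ?L_bound.
have [dis|ndis] := boolP [disjoint L d & Q].
  rewrite excessU //.
  (* The last piece has no later one to share a vertex with; the summand 1 of the bound pays for its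
     (t - 1)-st vertex. *)
  have [n0|n0] := posnP n.
    rewrite /U n0 big_nil setU0 mul1n; move: Pd; rewrite mulnDr; lia.
  have d2U : d.2 \in P d :&: U.
    rewrite !inE eqxx orbT /= /U -(prednK n0) trajectS big_cons.
    by rewrite !inE fstepE //= eqxx.
  have : 0 < #|P d :&: U| by apply/card_gt0P; exists d.2.
  by have := cardsUI (P d) U; rewrite mulnDr mulSn; lia.
(* A piece that meets a later one is equal to it and adds nothing to either union. *)
have [d' [d't Ld']] : exists d', d' \in traject (fstep G) (fstep G d) n /\ L d = L d'.
  have fs m e e' : e \in f -> e' \in traject (fstep G) e m -> e' \in f.
    elim: m e => //= m IHm e ef; rewrite inE => /orP[/eqP->//|].
    by apply: IHm; apply: sdf.
  case/pred0Pn: ndis => h /andP[/= hd]; rewrite /Q bigcup_seq => /bigcupP[d' d't hd'].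
  exists d'; split=> //; apply: L_eq => //; first exact: (fs n (fstep G d) d' (sdf d df) d't).
  by apply/pred0Pn; exists h; rewrite /= hd.
have L0 : L d != set0.
  by apply: contraNneq ndis => ->; rewrite disjoints_subset sub0set.
have -> : L d :|: Q = Q.
  by apply/setUidPr; rewrite Ld' /Q bigcup_seq; apply: bigcup_sup.
have -> : P d :|: U = U.
  apply/setUidPr; rewrite /P (setUidPr _) ?L_edge // Ld'.
  apply: (subset_trans (subsetUr (edge d') _)).
  by rewrite /U bigcup_seq; apply: (bigcup_sup d').
by apply: leq_trans IHd _; rewrite leq_add2r leq_add2l leq_mul2r leqnSn orbT.
Qed.


End Walk.

Lemma block_bound X : X \subset W -> X != set0 -> o \notin X ->
    conn (@dual_adj V) X -> conn (@dual_adj V) (W :\: X) ->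
  #|verts_of X| < t + (3 * t - 7) * excess X.
Proof.
have [n] := ubnP #|X|; elim: n X => // n IH X; rewrite ltnS => leX sXW X0 oX cX cO.
have rsym := @dual_adj_sym V.
have oO : o \in W :\: X by rewrite inE oX.
have [bad|/existsPn good] := boolP [exists h in X, 3 < #|h|]; last first.
  apply: leq_trans (leq_addr _ _); apply: small => // h hX.
  apply/eqP; rewrite eqn_leq (face_card_ge3 planeG twoG) ?(subsetP sXW) // andbT leqNgt.
  by have := good h; rewrite hX.
have [k [o' [kX o'O ko']]] : exists k o', [/\ k \in X, o' \in W :\: X & dual_adj k o'].
  case/set0Pn: X0 => x xX; have := oO; rewrite in_setD => /andP[_ oW'].
  have cW : conn (@dual_adj V) W by apply: dual_connected; case: planeG.
  have [y yC [k' k'O ryk]] := component_exit cW sXW xX oW' oX.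
  by exists y, k'; split=> //; exact: component_mem xX yC.
rewrite rsym in ko'.
have [B [f [[sBX gB] [cB cK] [cWB cWK] [fK f3] [a aP raf]]]] :=
  select_block rsym (fun g gW => dual_del planeG twoG gW) sXW cX cO o'O kX ko' bad.
set K := X :\: B in cK cWK fK *.
have sKX : K \subset X := subsetDl _ _.
have fX := subsetP sKX f fK; have fW := subsetP sXW f fX.
have aK : a \in W :\: K.
  case/orP: aP => [/andP[/setDP[aW aX] _]|aB].
    by rewrite !inE aW andbT; apply: contra aX => /andP[].
  by rewrite !inE aB /= (subsetP sXW) // (subsetP sBX).
have aW : a \in W by case/setDP: aK.
(* The edge of [e] leads from [f] to [B], or out of [X] if [B] is empty; the walk around [f] skips
   this edge. *)
have [e ef ea] : exists2 e, e \in f & flip e \in a.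
  by move: raf; rewrite rsym => /exists_inP.
have eG := face_dart fW ef.
set K' := K :\ f.
have sK'K : K' \subset K := subsetDl _ _.
have sK'X := subset_trans sK'K sKX.
have fK' : f \notin K' by rewrite !inE eqxx.
pose C h := component (@dual_adj V) K' h.
pose L d := if face_of G (flip d) \in K' then C (face_of G (flip d)) else set0.
have exitf h : h \in K' -> exists2 y, y \in C h & dual_adj y f.
  exact: component_exit1 cK fK.
have CB h : h \in K' -> #|verts_of (C h)| < t + (3 * t - 7) * excess (C h).
  move=> hK'; have sC : C h \subset K' := component_sub hK'.
  have sCX := subset_trans sC sK'X.
  apply: IH.
  - apply: leq_trans leX; apply: proper_card; apply/properP; split=> //.
    by exists f => //; apply: contra fK'; apply/subsetP.
  - exact: subset_trans sCX sXW.
  - by apply/set0Pn; exists h; apply: component_refl.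
  - by apply: contra oX; apply/subsetP.
  - exact: conn_comp.
  (* The complement of a component of [K'] is connected: [f] touches the complement of [K] at [a],
     and every other component touches [f]. *)
  have cH : conn (@dual_adj V) ((W :\: K) :|: [set f]).
    by apply: (connU rsym cWK (conn_set1 _ f) aK (set11 f)); rewrite rsym.
  apply: (conn_hub rsym cH).
    apply/subsetP=> g; rewrite in_setU in_set1 => /orP[/setDP[gW gK]|/eqP->].
      by rewrite inE gW andbT; apply: contra gK => /(subsetP sC)/(subsetP sK'K).
    by rewrite inE fW andbT; apply: contra fK'; apply/subsetP.
  move=> g /setDP[gW gC]; rewrite in_setU in_set1 in_setD gW andbT negb_or negbK.
  case/andP=> gK gf; have gK' : g \in K' by rewrite in_setD1 gf.
  exists (C g).
    split; [exact: conn_comp | | exact: component_refl].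
    apply/subsetP=> u uC; rewrite in_setD (component_disjoint rsym gC uC) /=.
    by apply: (subsetP sXW); apply: (subsetP sK'X); exact: component_mem gK' uC.
  have [y yC ryf] := exitf g gK'; exists y => //; exists f => //.
  by rewrite in_setU set11 orbT.
have sdf d : d \in f -> fstep G d \in f.
  by move=> df; rewrite (face_eq fW df) -face_of_fstep face_of_refl.
have Lsub d : L d \subset K'.
  by rewrite /L; case: ifP => [hK'|_]; [exact: component_sub hK' | exact: sub0set].
have walk := @card_walk (3 * t - 7) f L fW _ _ _ (#|f|.-1) _ (sdf e ef).
have {walk} walk :
  #|\bigcup_(d <- traject (fstep G) (fstep G e) #|f|.-1) (edge d :|: verts_of (L d))|
    <= 1 + #|f|.-1 * (t - 2) + (3 * t - 7) * excess K'.
  apply: leq_trans (walk _ _ _) _.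
  - move=> d d' df d'f /pred0Pn[h /andP[/= hd hd']].
    move: hd hd'; rewrite /L; case: ifP => _; case: ifP => _; rewrite ?in_set0 //.
    by move=> h1 h2; rewrite /C -(component_eq rsym h1) -(component_eq rsym h2).
  - move=> d df; rewrite /L; case: ifP => [hK' _|]; last by rewrite eqxx.
    have dG : flip d \in darts G by rewrite flip_dart (face_dart fW df).
    have := verts_of_face_of dG (component_refl (@dual_adj V) K' (face_of G (flip d))).
    rewrite -/(C _) => /andP[v1 v2].
    by apply/subsetP => x; rewrite !inE => /orP[]/eqP->.
  - move=> d df; rewrite /L; case: ifP => [hK' _|]; last by rewrite eqxx.
    exact: CB.
  - rewrite leq_add2l leq_mul2l excess_sub ?orbT // bigcup_seq.
    by apply/bigcupsP => d _; apply: Lsub.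
(* The walk meets every vertex of [K]. The tail of [e] is the head of the dart before [e], and each
   component of [K'] touches [f] along a dart other than [e], as [a] is outside [K]. *)
have vK : #|verts_of K| <= 1 + #|f|.-1 * (t - 2) + (3 * t - 7) * excess K'.
  apply: leq_trans walk; apply/subset_leq_card/subsetP => x /verts_ofP[h hK [d dh <-]].
  have tr d' : d' \in f -> d' != e -> d' \in traject (fstep G) (fstep G e) #|f|.-1.
    move=> d'f d'e; have : d' \in orbit (fstep G) e.
      by rewrite -fconnect_orbit; move: d'f; rewrite (face_eq fW ef) inE.
    rewrite /orbit -orderSpred trajectS inE (negPf d'e) /=.
    have -> // : #|f| = order (fstep G) e.
    by rewrite (face_eq fW ef); apply: eq_card => u; rewrite inE.
  rewrite bigcup_seq; apply/bigcupP.
  have [hf|hf] := eqVneq h f.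
    rewrite {h hK}hf in dh; have [->|de] := eqVneq d e; last first.
      by exists d; [apply: tr | rewrite !inE eqxx].
    have fe : fstep G (finv (fstep G) e) = e by rewrite f_finv //; apply: fstep_inj.
    have fd : finv (fstep G) e \in darts G by rewrite -fstep_dart fe.
    exists (finv (fstep G) e); last first.
      by rewrite !inE -{1 3}fe fstepE //= eqxx orbT.
    apply: tr.
      rewrite (face_eq fW ef) inE (fconnect_sym (@fstep_inj _ G)).
      by rewrite -{2}fe fconnect1.
    apply: contraTneq (triangle_walk planeG twoG eG) => fe'.
    have -> : fstep G e = e by rewrite -{1}fe' fe.
    by rewrite /= inE eqxx.
  have hK' : h \in K' by rewrite in_setD1 hf.
  have [y yC ryf] := exitf h hK'.
  move: ryf; rewrite rsym => /exists_inP[c cf cy].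
  have yK' : y \in K' := component_mem hK' yC.
  have yW : y \in W by rewrite (subsetP sXW) // (subsetP sK'X).
  have yE := face_eq yW cy.
  exists c.
    apply: tr => //; apply: contraTneq aK => ce.
    by rewrite (face_eq aW ea) -ce -yE in_setD (subsetP sK'K _ yK').
  rewrite in_setU; apply/orP; right; apply/verts_ofP; exists h; last by exists d.
  by rewrite /L -yE yK' /C (component_eq rsym yC) component_refl.
have eK : excess K = #|f| - 3 + excess K'.
  by rewrite /excess (big_setD1 f).
have eX : excess K <= excess X by apply: excess_sub.
(* A nonempty [B] has at most t - 1 vertices, and both ends of [e] also belong to [K]. *)
have vX : #|verts_of X| <= t - 3 + #|verts_of K|.
  have XE : X = B :|: K.
    by rewrite -{1}(setID X B) (setIidPr sBX).
  have [B0|B0] := eqVneq B set0; first by rewrite XE B0 set0U leq_addl.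
  have aB : a \in B by move: aP; rewrite (negPf B0) andbF.
  have : #|verts_of B| < t.
    apply: small => //; first exact: subset_trans sBX sXW.
      move=> h hB; apply/eqP; rewrite eqn_leq (face_card_ge3 planeG twoG) ?andbT.
        by rewrite leqNgt; apply: gB.
      by rewrite (subsetP sXW) // (subsetP sBX).
    by apply: contra oX; apply/subsetP.
  have : 2 <= #|verts_of B :&: verts_of K|.
    have <- : #|[set e.1; e.2]| = 2 by rewrite cards2 (dart_neq eG).
    apply/subset_leq_card/subsetP => x xe; rewrite inE.
    have fG : flip e \in darts G by rewrite flip_dart.
    have fcK : face_of G e \in K by rewrite -(face_eq fW ef).
    have fcB : face_of G (flip e) \in B by rewrite -(face_eq aW ea).
    have /andP[k1 k2] := verts_of_face_of eG fcK; have /andP[b1 b2] := verts_of_face_of fG fcB.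
    by move: xe; rewrite !inE => /orP[]/eqP->; apply/andP; split.
  have := cardsUI (verts_of B) (verts_of K); rewrite XE verts_ofU.
  move: #|verts_of B :|: _| #|_ :&: _| #|verts_of B| #|verts_of K| => b1 b2 b3 b4.
  by move: ht; clear; lia.
have le1 : (3 * t - 7) * (#|f| - 3 + excess K') <= (3 * t - 7) * excess X.
  by rewrite leq_mul2l -eK eX orbT.
rewrite mulnDr in le1.
have [F FE] : exists F, #|f| = F.+4 by exists (#|f| - 4); move: f3; clear; lia.
have [s sE] : exists s, t = s + 4 by exists (t - 4); move: ht; clear; lia.
(* Here the factor 3t - 7 arises: for |f| = 4 the left side is 4t - 8 = (t - 1) + (3t - 7), and each
   further side of [f] adds t - 2 on the left and 3t - 7 on the right. *)
have key : t - 3 + (1 + #|f|.-1 * (t - 2)) < t + (3 * t - 7) * (#|f| - 3).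
  rewrite FE sE /= (_ : s + 4 - 3 = s + 1); last by clear; lia.
  rewrite (_ : s + 4 - 2 = s + 2); last by clear; lia.
  rewrite (_ : 3 * (s + 4) - 7 = 3 * s + 5); last by clear; lia.
  rewrite (_ : F.+4 - 3 = F.+1); last by clear; lia.
  by clear; nia.
move: vX vK le1 key; clear.
move: (_ * (t - 2)) (_ * excess K') (_ * (#|f| - 3)) (_ * excess X) #|_| #|_|.
by move=> b1 b2 b3 b4 b5 b6; lia.
Qed.

End Bound.
End Counting.

(** * Excess and vertices of the disc of all inner faces *)

Section EdgeCount.
Variables (V : finType) (G : embedded_graph V).

Lemma card_darts : #|darts G| = 2 * #|edges G|.
Proof.
rewrite -sum1_card (partition_big (fun d => edge d) (mem (edges G))) /=; last first.
  by move=> d; apply: edge_edges.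
rewrite mulnC -sum_nat_const; apply: eq_bigr => e /edgesP[d dG ->].
rewrite sum1_card -(_ : #|[set d; flip d]| = 2); last first.
  rewrite cards2; suff -> : d != flip d by [].
  by case: d dG => a b /dart_neq /=; rewrite /flip xpair_eqE => /negPf->.
apply: eq_card => d'; rewrite !inE -!topredE /= (edge_eq _ dG).
by apply/andP/idP => [[]//|h]; split=> //; case/orP: h => /eqP->; rewrite ?flip_dart.
Qed.

Lemma sum_card_faces : \sum_(h in faces G G) #|h| = #|darts G|.
Proof.
rewrite -[RHS]sum1_card [RHS](partition_big (face_of G) (mem (faces G G))) /=; last first.
  by move=> d; apply: face_of_faces.
apply: eq_bigr => h hF; rewrite sum1_card; apply: eq_card => d.
rewrite -!topredE /=; apply/idP/andP => [dh|[_ /eqP<-]]; last exact: face_of_refl.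
by rewrite (face_dart hF dh) (face_eq hF dh).
Qed.

(** The inner faces have 2e - |C| sides in total, so the excess is 2e - |C| - 3(f - 1), and Euler's
    formula eliminates f. *)
Lemma excess_missing_edges C d : plane G -> two_connected G -> facial_cycle G C ->
    d \in cycle_darts C ->
  ((excess (faces G G :\ face_of G d))%:Z = missing_edges G C)%R.
Proof.
move=> planeG twoG facC dC; have dW := face_of_faces (cycle_darts_dart facC dC).
have s1 : \sum_(h in faces G G :\ face_of G d) #|h| + size C = 2 * #|edges G|.
  by rewrite -card_darts -sum_card_faces (big_setD1 _ dW) /= (card_cycle_face facC dC) addnC.
have s2 : excess (faces G G :\ face_of G d) + 3 * #|faces G G :\ face_of G d|
    = \sum_(h in faces G G :\ face_of G d) #|h|.
  rewrite mulnC -sum_nat_const /excess -big_split /=.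
  by apply: eq_bigr => h /setD1P[_ hF]; rewrite subnK // (face_card_ge3 planeG twoG).
have s3 := cardsD1 (face_of G d) (faces G G); rewrite dW in s3.
have := planeG.2; rewrite /missing_edges /nb_verts /nb_edges.
move: s1 s2 s3; clear; move: (excess _) #|_ :\ _| #|faces G G| #|verts G| #|edges G| (size C).
by move=> b1 b2 b3 b4 b5 b6; lia.
Qed.

(** A vertex has two neighbours, and the outer face leaves it along at most one dart, so another
    dart from it lies on an inner face. *)
Lemma verts_of_inner C d : plane G -> two_connected G -> facial_cycle G C ->
    d \in cycle_darts C ->
  verts_of (faces G G :\ face_of G d) = verts G.
Proof.
move=> planeG twoG facC dC; apply/setP=> x; apply/idP/idP.
  case/verts_ofP=> h /setD1P[_ hF] [e eh <-].
  by apply: (@adj_verts _ _ _ e.2); rewrite -dartE (face_dart hF eh).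
move=> xG; have [y yG /andP[yx _]] := third_vertex twoG x x.
have [z xz _] := second_neighbour planeG twoG xG yx.
have zx : z != x by apply: contraTneq xz => ->; rewrite adj_irr.
have [z' xz' zz'] := second_neighbour planeG twoG xG zx.
have main u : adj G x u -> (x, u) \notin face_of G d ->
    x \in verts_of (faces G G :\ face_of G d).
  move=> xu nu; have uG : (x, u) \in darts G by rewrite dartE.
  apply/verts_ofP; exists (face_of G (x, u)); last by exists (x, u); rewrite ?face_of_refl.
  by rewrite in_setD1 face_of_faces // andbT; apply: contraNneq nu => <-; apply: face_of_refl.
have [o1|] := boolP ((x, z) \in face_of G d); last exact: main.
have [o2|] := boolP ((x, z') \in face_of G d); last exact: main.
move: o1 o2; rewrite !(cycle_darts_face_of facC) // => /mapP[a _ [<- zE]] /mapP[b _ [<- zE']].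
by rewrite zE zE' eqxx in zz'.
Qed.

End EdgeCount.

(** * The near triangulation, by contradiction with the vertex bound *)

Local Open Scope ring_scope.

Theorem theorem1p4 (t : nat) (V : finType) (G : embedded_graph V) (C : seq V)
    (ht : (4 <= t)%N) (hGC : circuit_graph G C) (hv : (t <= nb_verts G)%N)
    (hm : (missing_edges G C)%:~R <
          ((nb_verts G)%:R - (t%:R - 1)) / (3 * t%:R - 7) :> rat) :
  exists T : graph V,
    [/\ subgraph T G, near_triangulation G C T & (t <= nb_verts T)%N].
Proof.
case: hGC => planeG twoG facC _.
have [d dC] := cycle_darts_nonempty facC.
have dG := cycle_darts_dart facC dC; have oW := face_of_faces dG.
set o := face_of G d in oW; set W := faces G G in oW.
pose block (X : {set {set V * V}}) := [&& X \subset W, X != set0,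
  conn (@dual_adj V) X, conn (@dual_adj V) (W :\: X), [forall h : {set V * V} in X, #|h| == 3%N],
  o \notin X & (t <= #|verts_of X|)%N].
have [/existsP[X /and5P[sX X0 cX cO /and3P[/forall_inP tri oX tX]]]|/existsPn none] :=
  boolP [exists X, block X].
  exists (face_graph G X); split=> //; first exact: face_graph_sub.
  apply: face_graph_near_triangulation => //; first by move=> h /tri/eqP.
  by move=> e eC; rewrite -(face_of_eq (d := e) (d' := d)) // (cycle_darts_face_of facC).
have small (X : {set {set V * V}}) : X \subset W -> X != set0 -> conn (@dual_adj V) X ->
    conn (@dual_adj V) (W :\: X) -> {in X, forall h : {set V * V}, #|h| = 3%N} -> o \notin X ->
    (#|verts_of X| < t)%N.
  move=> sX X0 cX cO tri oX; have := none X; rewrite /block sX X0 cX cO oX /=.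
  suff -> : [forall h : {set V * V} in X, #|h| == 3%N] by rewrite -ltnNge.
  by apply/forall_inP=> h /tri->.
have vW := verts_of_inner planeG twoG facC dC.
have X0 : W :\ o != set0.
  apply: contraTneq hv => e0; rewrite /nb_verts -vW -/o -/W e0 /verts_of big_set0 cards0.
  by rewrite -ltnNge; apply: leq_trans ht.
have oX : o \notin W :\ o by rewrite in_setD1 eqxx.
have cO : conn (@dual_adj V) (W :\: (W :\ o)).
  by rewrite setDDr setDv set0U (setIidPr _) ?sub1set // conn_set1.
(* The inner faces form a disc because deleting the outer face leaves the dual connected. *)
have := block_bound planeG twoG oW ht small (subsetDl _ _) X0 oX (dual_del planeG twoG oW) cO.
rewrite vW => bound; exfalso.
move: hm; rewrite -(excess_missing_edges planeG twoG facC dC) -/o -/W /nb_verts.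
move: (excess _) #|verts G| bound => m v bound.
have t7 : 0 < 3 * t%:R - 7 :> rat.
  have : 4%:R <= t%:R :> rat by rewrite ler_nat.
  by clear; lra.
rewrite ltr_pdivlMr //.
(* This says v - (t - 1) <= (3t - 7) m, against [hm]; passing the subtraction to the rationals uses
   7 <= 3t. *)
have : v.+1%:R <= (t + (3 * t - 7) * m)%:R :> rat by rewrite ler_nat.
rewrite natrD natrM natrB; last by move: ht; clear; lia.
by rewrite natrM -natr1 -pmulrn; clear; lra.
Qed.
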